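(* Let $f:M\to M$ be a local homeomorphism satisfying (H1) and (H2), and let $\mathcal W$ be an open set of potentials in $C^\alpha(M,\mathbb R)$, $\alpha>0$, satisfying (P), endowed with the $C^\alpha$-topology. The spectral radius map $\mathcal W\ni\phi\mapsto\lambda_{f,\phi}$ is analytic. Furthermore, given $\phi_0\in\mathcal W$ and $H\in C^\alpha(M,\mathbb R)$, $$D_\phi\lambda_{f,\phi}|_{\phi_0}\cdot H=\lambda_{f,\phi_0}\cdot\int h_{f,\phi_0}\cdot H\,d\nu_{f,\phi_0}.$$
   Context: $M$ is a compact connected Riemannian manifold with distance $d$. For the local homeomorphism $f:M\to M$ there is assumed a function $x\mapsto L(x)$ such that every $x$ has a neighborhood $U_x$ with $f_x=f|_{U_x}:U_x\to f(U_x)$ invertible and $d(f_x^{-1}(y),f_x^{-1}(z))\le L(x)d(y,z)$ on $f(U_x)$; $\deg(f)$ is the (constant) number of preimages. There are constants $\sigma>1$, $L\ge1$ and an open $\mathcal A\subset M$ with (H1) $L(x)\le L$ for $x\in\mathcal A$, $L(x)<\sigma^{-1}$ for $x\notin\mathcal A$, and $L$ close to $1$ in the sense of (E1)-(E2) below; (H2) there is a finite covering $\mathcal U$ of $M$ by open domains of injectivity of $f$ such that $\mathcal A$ is covered by $q<\deg(f)$ elements of $\mathcal U$. (P) for an $\alpha$-Hölder potential $\phi$: $\sup\phi-\inf\phi<\varepsilon_\phi$ and $|e^\phi|_\alpha<\varepsilon_\phi e^{\inf\phi}$, with $|\cdot|_\alpha$ the $\alpha$-Hölder constant. Here $\varepsilon_\phi>0$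 is a small constant depending only on $L,\sigma,q,\deg(f)$, a small $\delta>0$ and a positive integer $m$ such that functions that are $(C,\alpha)$-Hölder on $\delta$-balls are globally $(Cm,\alpha)$-Hölder; the constants satisfy, with $K=\frac{(\deg(f)-q)\sigma^{-\alpha}+qL^\alpha[1+(L-1)^\alpha]}{\deg(f)}$, (E1) $e^{\varepsilon_\phi}K+2m\varepsilon_\phi L^\alpha\operatorname{diam}(M)^\alpha<1$; (E2) $(1+\varepsilon_\phi)e^{\varepsilon_\phi}K<1$. $\mathcal L_{f,\phi}(g)(x)=\sum_{f(y)=x}e^{\phi(y)}g(y)$; $\lambda_{f,\phi}$ is its spectral radius. It is known that there is a conformal probability measure $\nu_{f,\phi}$ with $\mathcal L_{f,\phi}^*\nu_{f,\phi}=\lambda_{f,\phi}\nu_{f,\phi}$ and a unique Hölder $h_{f,\phi}$ with $\mathcal L_{f,\phi}h_{f,\phi}=\lambda_{f,\phi}h_{f,\phi}$, $\int h_{f,\phi}\,d\nu_{f,\phi}=1$. $D_\phi$ is the Fréchet derivative in $\phi$. A map between Banach spaces is analytic if near each point it is given by a uniformly convergent power series $\sum_i\frac1{i!}P_i(h,\dots,h)$ with $P_i$ bounded symmetric $i$-linear maps. *)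

(* Defs.v *)
From HB Require Import structures.
From mathcomp Require Import all_boot all_order all_algebra all_fingroup.
From mathcomp Require Import complex.
From mathcomp Require Import all_classical all_reals all_analysis.
Set Implicit Arguments.
Unset Strict Implicit.
Unset Printing Implicit Defensive.
Import Order.TTheory GRing.Theory Num.Theory.
Import numFieldNormedType.Exports.
Local Open Scope classical_set_scope.
Local Open Scope ring_scope.

(* A base point is required by the library to make the Borel sigma-algebra
   a [measurableType]; it only says that the space is nonempty. *)
#[short(type="pointedMetricType")]
HB.structure Definition PointedMetric (R : numDomainType) :=
  { M of PseudoPointedMetric R M & Metric R M }.

Section Riemannian.
Context {R : realType}.

(* [g] is C^k on the open set [O]: [g] is continuous on [O] and its first
   partial derivatives exist on [O] and are C^(k-1) there. *)
Fixpoint Ck n (k : nat) (O : set 'rV[R]_n) (g : 'rV[R]_n -> R) : Prop :=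
  (forall u, O u -> {for u, continuous g}) /\
  if k is k'.+1 then
    forall j : 'I_n,
      (forall u, O u -> derivable g u (delta_mx 0 j)) /\
      Ck k' O (fun u => 'D_(delta_mx 0 j) g u)
  else True.

Definition smooth_on n (O : set 'rV[R]_n) (g : 'rV[R]_n -> R) : Prop :=
  forall k, Ck k O g.

Variable M : metricType R.

(* [chart_map] is only meaningful on [chart_dom], and [chart_inv] on
   [chart_img]. *)
Record chart n := Chart {
  chart_dom : set M;
  chart_map : M -> 'rV[R]_n;
  chart_inv : 'rV[R]_n -> M }.

Definition chart_img n (c : chart n) : set 'rV[R]_n :=
  chart_map c @` chart_dom c.

Definition is_chart n (c : chart n) : Prop :=
  [/\ open (chart_dom c), open (chart_img c),
      {in chart_dom c, cancel (chart_map c) (chart_inv c)},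
      {within chart_dom c, continuous (chart_map c)} &
      {within chart_img c, continuous (chart_inv c)}].

Definition overlap n (c c' : chart n) : set 'rV[R]_n :=
  chart_map c @` (chart_dom c `&` chart_dom c').

Definition transition n (c c' : chart n) : 'rV[R]_n -> 'rV[R]_n :=
  fun u => chart_map c' (chart_inv c u).

(* A smooth atlas together with a smooth Riemannian metric, given by its
   matrix [gram i u] at the point of coordinates [u] in the chart [i].
   Tangent vectors are row vectors, so a change of chart maps the coordinates
   [v] of a tangent vector to [v *m 'J (transition _ _) u]. *)
Record riemannian_structure n := RiemannianStructure {
  chart_index : Type;
  atlas : chart_index -> chart n;
  gram : chart_index -> 'rV[R]_n -> 'M[R]_n;
  atlas_chart : forall i, is_chart (atlas i);
  atlas_cover : forall x : M, exists i, chart_dom (atlas i) x;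
  atlas_smooth : forall i j k,
    smooth_on (overlap (atlas i) (atlas j))
      (fun u => transition (atlas i) (atlas j) u 0 k);
  gram_smooth : forall i k l,
    smooth_on (chart_img (atlas i)) (fun u => gram i u k l);
  gram_sym : forall i u, chart_img (atlas i) u -> (gram i u)^T = gram i u;
  gram_pos : forall i u (v : 'rV[R]_n), chart_img (atlas i) u -> v != 0 ->
    0 < (v *m gram i u *m v^T) 0 0;
  gram_change : forall i j u, overlap (atlas i) (atlas j) u ->
    let J := 'J (transition (atlas i) (atlas j)) u in
    gram i u = J *m gram j (transition (atlas i) (atlas j) u) *m J^T }.

(* [l] is the length of a C^1 curve from [x] to [y] contained in the domain of
   a single chart; [c] is the curve in coordinates, extended to a C^1 function
   on the whole line. *)
Definition segment_length n (S : riemannian_structure n) (x y : M) (l : R) :=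
  exists (i : chart_index S) (c : R -> 'rV[R]_n),
    [/\ forall t, derivable c t 1,
        continuous (derive1 c),
        (forall t, 0 <= t <= 1 -> chart_img (atlas i) (c t)),
        chart_inv (atlas i) (c 0) = x /\ chart_inv (atlas i) (c 1) = y &
        l = \int[lebesgue_measure]_(t in `[0, 1])
              Num.sqrt ((derive1 c t *m gram i (c t) *m (derive1 c t)^T) 0 0)].

(* Piecewise C^1 curves: by compactness of the interval of parameters, these
   are the finite concatenations of C^1 curves contained in charts. *)
Inductive curve_length n (S : riemannian_structure n) : M -> M -> R -> Prop :=
| curve_nil x : curve_length S x x 0
| curve_cons x y z l l' : segment_length S x y l -> curve_length S y z l' ->
    curve_length S x z (l + l').

(* The distance of [M] is the Riemannian distance of some Riemannian structure
   compatible with the topology of [M]. *)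
Definition riemannian_manifold : Prop :=
  exists n (S : riemannian_structure n), forall x y : M,
    mdist x y = inf [set l | curve_length S x y l].

Definition compact_connected_riemannian_manifold : Prop :=
  [/\ compact [set: M], connected [set: M] & riemannian_manifold].

End Riemannian.

Section Analytic.
Context {R : realType} {V W : normedModType R}.

Definition multilinear_map i (P : ('I_i -> V) -> W) : Prop :=
  forall (v : 'I_i -> V) (j : 'I_i) (a : R) (u w : V),
    let upd x := fun k => if k == j then x else v k in
    P (upd (a *: u + w)) = a *: P (upd u) + P (upd w).

Definition symmetric_map i (P : ('I_i -> V) -> W) : Prop :=
  forall (v : 'I_i -> V) (s : 'S_i), P (v \o s) = P v.

Definition bounded_map i (P : ('I_i -> V) -> W) : Prop :=
  exists C : R, forall v : 'I_i -> V, `|P v| <= C * \prod_(k < i) `|v k|.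

Definition analytic_at (F : V -> W) (a : V) : Prop :=
  exists P : forall i, ('I_i -> V) -> W,
    (forall i, [/\ multilinear_map (P i), symmetric_map (P i)
                 & bounded_map (P i)]) /\
    exists r : R, 0 < r /\
      {uniform ball (0 : V) r,
        (fun n (h : V) => \sum_(i < n) (i`!%:R)^-1 *: P i (fun=> h)) @ \oo
          --> (fun h : V => F (a + h))}.

Definition analytic_on (A : set V) (F : V -> W) : Prop :=
  forall a, A a -> analytic_at F a.

End Analytic.

Section Spectrum.
Context {R : realType} {V : normedModType R}.

(* [z - T] on the complexification V + iV, whose elements are written as
   pairs (real part, imaginary part). *)
Definition complex_pencil (T : V -> V) (z : R[i]) (w : V * V) : V * V :=
  (complex.Re z *: w.1 - complex.Im z *: w.2 - T w.1,
   complex.Re z *: w.2 + complex.Im z *: w.1 - T w.2).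

Definition in_resolvent (T : V -> V) (z : R[i]) : Prop :=
  exists S : V * V -> V * V,
    [/\ continuous S, cancel (complex_pencil T z) S
      & cancel S (complex_pencil T z)].

Definition spectrum (T : V -> V) : set R[i] := [set z | ~ in_resolvent T z].

Definition spectral_radius (T : V -> V) : R :=
  sup [set ComplexField.Normc.normc z | z in spectrum T].

End Spectrum.

Section Hoelder.
Context {R : realType} (M : pointedMetricType R) (alpha : R).
Implicit Types (g : M -> R).

(* The bound on [g] makes the norm below finite on any [M]; it is automatic
   when [M] is compact and [alpha > 0]. *)
Definition hoelder g : Prop :=
  exists C : R, (forall x, `|g x| <= C) /\
    forall x y, `|g x - g y| <= C * mdist x y `^ alpha.

Definition sup_norm g : R := sup (range (fun x => `|g x|)).

Definition hoelder_const g : R :=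
  sup [set r | exists x y, x != y /\ r = `|g x - g y| / mdist x y `^ alpha].

Definition hoelder_pred : {pred M -> R} := fun g => `[< hoelder g >].

Record hoelder_space := HoelderSpace {
  hoelder_fun :> M -> R;
  _ : hoelder_fun \in hoelder_pred }.

HB.instance Definition _ := [isSub for hoelder_fun].
HB.instance Definition _ := [Choice of hoelder_space by <:].

Lemma hoelder_submod_closed : submod_closed hoelder_pred.
Proof.
split=> [|a g k /asboolP[C [C1 C2]] /asboolP[D [D1 D2]]]; apply/asboolP.
  exists 0; split=> [x|x y]; first by rewrite normr0.
  by rewrite subr0 normr0 mul0r.
exists (`|a| * C + D); split=> [x|x y].
  rewrite (le_trans (ler_normD _ _))// lerD// normrM.
  by rewrite ler_wpM2l.
rewrite /= -[leLHS]/(`|(a * g x + k x) - (a * g y + k y)|).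
rewrite opprD addrACA -mulrBr (le_trans (ler_normD _ _))// mulrDl lerD//.
by rewrite normrM -mulrA ler_wpM2l.
Qed.

HB.instance Definition _ :=
  GRing.isSubmodClosed.Build R (M -> R) hoelder_pred hoelder_submod_closed.
HB.instance Definition _ :=
  [SubChoice_isSubLmodule of hoelder_space by <:].

Definition hoelder_norm (g : hoelder_space) : R := sup_norm g + hoelder_const g.

Lemma hoelderP (g : hoelder_space) : hoelder g.
Proof. by case: g => g /= /asboolP. Qed.

Lemma sup_norm_ub (g : hoelder_space) x : `|g x| <= sup_norm g.
Proof.
apply: ub_le_sup; last by exists x.
by have [C [C1 _]] := hoelderP g; exists C => _ [y _ <-].
Qed.

Lemma hoelder_const_ub (g : hoelder_space) x y : x != y ->
  `|g x - g y| / mdist x y `^ alpha <= hoelder_const g.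
Proof.
move=> xy; apply: ub_le_sup; last by exists x, y.
have [C [_ C2]] := hoelderP g; exists C => _ [u [v [uv ->]]].
rewrite ler_pdivrMr// powR_gt0// lt_neqAle mdist_ge0 andbT eq_sym.
by apply: contra_neq uv => /mdist_positivity.
Qed.

Lemma sup_norm_le g C : (forall x, `|g x| <= C) -> sup_norm g <= C.
Proof.
move=> gC; apply: ge_sup; first by exists `|g point|, point.
by move=> _ [x _ <-].
Qed.

Lemma hoelder_const_le g C : 0 <= C ->
  (forall x y, x != y -> `|g x - g y| / mdist x y `^ alpha <= C) ->
  hoelder_const g <= C.
Proof.
move=> C0 gC; rewrite /hoelder_const; set S := [set _ | _].
have [->|/set0P S0] := eqVneq S set0; first by rewrite sup0.
by apply: ge_sup => // _ [x [y [xy ->]]]; exact: gC.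
Qed.

Lemma hoelder_const_ge0 (g : hoelder_space) : 0 <= hoelder_const g.
Proof.
rewrite /hoelder_const; set S := [set _ | _].
have [->|/set0P[_ [x [y [xy _]]]]] := eqVneq S set0; first by rewrite sup0.
by apply: le_trans (hoelder_const_ub g xy); rewrite divr_ge0// powR_ge0.
Qed.

Lemma hoelder_normD (g k : hoelder_space) :
  hoelder_norm (g + k) <= hoelder_norm g + hoelder_norm k.
Proof.
rewrite /hoelder_norm addrACA lerD//.
  apply: sup_norm_le => x; rewrite (le_trans (ler_normD _ _))//.
  by rewrite lerD// sup_norm_ub.
apply: hoelder_const_le => [|x y xy].
  by rewrite addr_ge0// hoelder_const_ge0.
apply: le_trans (lerD (hoelder_const_ub g xy) (hoelder_const_ub k xy)).
rewrite -mulrDl ler_wpM2r ?invr_ge0 ?powR_ge0//.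
by rewrite /= opprD addrACA ler_normD.
Qed.

Lemma hoelder_normZ_le (a : R) (g : hoelder_space) :
  hoelder_norm (a *: g) <= `|a| * hoelder_norm g.
Proof.
rewrite /hoelder_norm mulrDr lerD//.
  apply: sup_norm_le => x; rewrite -[(a *: g) x]/(a * g x) normrM.
  by rewrite ler_wpM2l// sup_norm_ub.
apply: hoelder_const_le => [|x y xy].
  by rewrite mulr_ge0// hoelder_const_ge0.
rewrite -[(a *: g) x]/(a * g x) -[(a *: g) y]/(a * g y) -mulrBr normrM -mulrA.
by rewrite ler_wpM2l// hoelder_const_ub.
Qed.

Lemma hoelder_normZ (a : R) (g : hoelder_space) :
  hoelder_norm (a *: g) = `|a| * hoelder_norm g.
Proof.
apply/eqP; rewrite eq_le hoelder_normZ_le/=.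
have [->|a0] := eqVneq a 0.
  rewrite normr0 mul0r addr_ge0// ?hoelder_const_ge0//.
  exact: le_trans (sup_norm_ub (0 *: g) point).
rewrite -ler_pdivlMl ?normr_gt0// -normfV.
by rewrite -[X in hoelder_norm X <= _](scalerK a0) hoelder_normZ_le.
Qed.

Lemma hoelder_norm0_eq0 (g : hoelder_space) : hoelder_norm g = 0 -> g = 0.
Proof.
move=> g0; apply/val_inj/funext => x /=.
apply/eqP; rewrite -normr_le0 -g0.
by rewrite (le_trans (sup_norm_ub g x))// lerDl hoelder_const_ge0.
Qed.

HB.instance Definition _ := Lmodule_isNormed.Build R hoelder_space
  hoelder_normD hoelder_normZ hoelder_norm0_eq0.

End Hoelder.

Notation borel M := (g_sigma_algebraType (@open M)).

Section Dynamics.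
Context {R : realType} (M : pointedMetricType R) (alpha : R).

Definition diam : R := sup [set r : R | exists x y : M, r = mdist x y].

(* In the next two definitions [g] is the inverse of the restriction of [f] to
   [U]; its values outside [f @` U] are irrelevant. *)
Definition local_homeomorphism (f : M -> M) : Prop :=
  forall x, exists (U : set M) (g : M -> M),
    [/\ open U /\ U x, open (f @` U), {in U, cancel f g},
        {within U, continuous f} & {within f @` U, continuous g}].

Definition inverse_branch_lipschitz (f : M -> M) (Lf : M -> R) : Prop :=
  forall x, exists (U : set M) (g : M -> M),
    [/\ nbhs x U, {in U, cancel f g} &
        forall y z, (f @` U) y -> (f @` U) z ->
          mdist (g y) (g z) <= Lf x * mdist y z].

Definition has_degree (f : M -> M) (p : nat) : Prop :=
  forall x, (f @^-1` [set x] #= `I_p)%card.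

Definition hyp_H1 (Lf : M -> R) (A : set M) (sigma L : R) : Prop :=
  (forall x, A x -> Lf x <= L) /\ (forall x, ~ A x -> Lf x < sigma^-1).

Definition hyp_H2 (f : M -> M) (A : set M) (q : nat) : Prop :=
  exists UU : set (set M),
    [/\ finite_set UU,
        (forall U, UU U -> open U /\ set_inj U f),
        \bigcup_(U in UU) U = [set: M] &
        exists QQ : set (set M),
          [/\ QQ `<=` UU, (QQ #= `I_q)%card & A `<=` \bigcup_(U in QQ) U]].

(* Functions that are (C, alpha)-Hoelder on each ball of radius [delta] are
   globally (C m, alpha)-Hoelder. *)
Definition local_to_global (delta : R) (m : nat) : Prop :=
  forall (C : R) (g : M -> R), 0 <= C ->
    (forall x y z, ball x delta y -> ball x delta z ->
       `|g y - g z| <= C * mdist y z `^ alpha) ->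
    forall y z, `|g y - g z| <= C * m%:R * mdist y z `^ alpha.

Definition const_K (L sigma : R) (q p : nat) : R :=
  ((p%:R - q%:R) * sigma `^ (- alpha)
     + q%:R * L `^ alpha * (1 + (L - 1) `^ alpha)) / p%:R.

Definition cond_E1 (eps L sigma : R) (q p m : nat) : Prop :=
  expR eps * const_K L sigma q p
    + 2 * m%:R * eps * L `^ alpha * diam `^ alpha < 1.

Definition cond_E2 (eps L sigma : R) (q p : nat) : Prop :=
  (1 + eps) * expR eps * const_K L sigma q p < 1.

Definition hyp_P (eps : R) (phi : hoelder_space M alpha) : Prop :=
  sup (range phi) - inf (range phi) < eps /\
  hoelder_const alpha (expR \o phi) < eps * expR (inf (range phi)).

Definition transfer_fun (f : M -> M) (phi g : M -> R) : M -> R :=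
  fun x => \sum_(y \in f @^-1` [set x]) expR (phi y) * g y.

(* The transfer operator acting on C^alpha. For a local homeomorphism with
   Lipschitz inverse branches of a compact space, [transfer_fun f phi g] is
   alpha-Hoelder, so that the default value 0 is never used. *)
Definition transfer (f : M -> M) (phi g : hoelder_space M alpha) :
    hoelder_space M alpha :=
  insubd (0 : hoelder_space M alpha) (transfer_fun f phi g).

Definition lambda (f : M -> M) (phi : hoelder_space M alpha) : R :=
  spectral_radius (transfer f phi).

(* The identity [L^* nu = lambda nu] of measures, i.e. of functionals on
   the space of continuous functions. *)
Definition conformal (f : M -> M) (phi : hoelder_space M alpha)
    (nu : probability (borel M) R) : Prop :=
  forall g : M -> R, continuous g ->
    \int[nu]_x transfer_fun f phi g x = lambda f phi * \int[nu]_x g x.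

Definition normalized_eigenfunction (f : M -> M) (phi : hoelder_space M alpha)
    (nu : probability (borel M) R) (h : hoelder_space M alpha) : Prop :=
  (forall x, transfer_fun f phi h x = lambda f phi * h x) /\
  \int[nu]_x h x = 1.

End Dynamics.

(* Main.v *)
Require Import Defs.
From HB Require Import structures.
From mathcomp Require Import all_boot all_order all_algebra all_fingroup.
From mathcomp Require Import complex.
From mathcomp Require Import all_classical all_reals all_analysis.
From mathcomp Require Import measurable_realfun.
From mathcomp Require Import ring lra zify.
Import Order.TTheory GRing.Theory Num.Theory.
Import numFieldNormedType.Exports.
Local Open Scope classical_set_scope.
Local Open Scope ring_scope.

(** The idea is to treat the leading eigenvalue of the transfer operator as an
    isolated simple eigenvalue, and to expand it by the perturbation series of
    its eigenvalue equation.

    Every inverse branch of [f] whose centre lies outside [A] contracts, and at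
    most [q] of the [deg f] branches have their centre in [A]. Matching the
    fibres of nearby points by inverse branches (matched_fibres_uniform)
    gives a Lasota-Yorke inequality for the transfer operator [T] of a
    potential [phi0] (transfer_hoelder_const): up to a multiple of the sup
    norm, [T] multiplies the Hoelder constant by at most a rate which
    (total_rate_contraction, lambda_ge) is strictly smaller than the
    leading eigenvalue [l0]. Since the unit ball of the Hoelder space is
    compact for the sup norm, [z - T] is then bounded below for [z] in a
    compact interval above that rate as soon as it is injective there
    (lasota_yorke_bounded_below).

    Injectivity comes for free. Above [l0] it holds because [l0] is the
    spectral radius (eigenvalue_le_spectral_radius). At [l0], on the kernel
    of the conformal measure, it is the uniqueness of the normalised
    eigenfunction (deflated_injective). The method of continuity turns the
    lower bounds into an inverse of [l0 - T] on that kernel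
    (deflated_resolvent).

    The potential [phi0 + H] has the operator [g |-> T (e^H g)]
    (transferD). With the inverse at hand, the equation
    [T (e^H (h0 + w)) = (l0 + z) (h0 + w)], [nu w = 0], becomes a quadratic
    fixed point equation in a Banach space whose source is a power series in
    [H]. The solution is again a power series
    (quadratic_equation_solution, eigenvalue_branch); its term of degree [1]
    is [l0 * nu (H h0)], which is the announced derivative.

    It remains to see that the perturbed eigenvalue is [lambda f (phi0 + H)]
    (lambda_expansion). The latter is not smaller, being a spectral radius.
    It is an eigenvalue itself, so it cannot be much larger than [l0]: there
    [z - T] is bounded below (perturbed_eigenvalue_lt). And
    near [l0] the perturbed operator has only one eigenvalue
    (eigenvalue_unique). *)

Set Implicit Arguments.
Unset Strict Implicit.
Unset Printing Implicit Defensive.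

(** * Bounded operators on a Banach space *)

Section BoundedOperators.
Context {R : realType}.

Lemma linear_bound_continuous (V W : normedModType R) (A : {linear V -> W})
    (C : R) : (forall x, `|A x| <= C * `|x|) -> continuous A.
Proof.
move=> AC; apply: bounded_linear_continuous.
apply/linear_boundedP; near=> r => x.
by rewrite (le_trans (AC x))// ler_wpM2r//; near: r; exact: nbhs_pinfty_ge.
Unshelve. all: by end_near. Qed.

Lemma bounded_below_inverse (V W : normedModType R) (A : {linear V -> W})
    (c : R) : 0 < c -> (forall x, c * `|x| <= `|A x|) ->
  (forall y, exists x, A x = y) ->
  exists S : {linear W -> V}, [/\ cancel A S, cancel S A &
    forall y, `|S y| <= c^-1 * `|y|].
Proof.
move=> c0 Ac /choice[S AS].
have Ainj x y : A x = A y -> x = y.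
  move=> Axy; apply/eqP; rewrite -subr_eq0 -normr_le0.
  by rewrite -(pmulr_rle0 _ c0) (le_trans (Ac _))// linearB/= Axy subrr normr0.
have Slin : linear S.
  by move=> a x y; apply: Ainj; rewrite linearP !AS.
pose S' : {linear W -> V} :=
  HB.pack S (GRing.isLinear.Build _ _ _ _ S Slin).
exists S'; split => [x|y|y]; rewrite /S'/=; first by apply: Ainj; rewrite AS.
  by rewrite AS.
by rewrite ler_pdivlMl// (le_trans (Ac _))// AS.
Qed.

Lemma neumann_surjective (V : completeNormedModType R) (B : {linear V -> V})
    (k : R) : k < 1 -> (forall x, `|B x| <= k * `|x|) ->
  forall y, exists x, x - B x = y.
Proof.
move=> k1 Bk y; wlog k0 : k k1 Bk / 0 <= k => [wl|].
  apply: (wl (Num.max k 0)); rewrite ?le_max ?lexx ?orbT//.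
    by rewrite gt_max k1 ltr01.
  by move=> x; rewrite (le_trans (Bk x))// ler_wpM2r// le_max lexx.
pose u n := iter n B y.
have uk n : `|u n| <= `|y| * k ^+ n.
  elim: n => [|n IH]; first by rewrite expr0 mulr1.
  by rewrite exprS (le_trans (Bk _))// mulrCA ler_wpM2l.
have cu : cvgn (series u).
  apply: normed_cvg; apply: (@series_le_cvg _ _ (fun n => `|y| * k ^+ n)).
  - by move=> n /=.
  - by move=> n; apply: mulr_ge0 => //; exact: exprn_ge0.
  - by move=> n; exact: uk.
  have := @is_cvg_geometric_series _ `|y| k.
  by rewrite ger0_norm//; apply.
exists (limn (series u)); apply/eqP; rewrite subr_eq; apply/eqP.
have Bc := linear_bound_continuous Bk.
apply: (@cvg_unique _ (@norm_hausdorff _ V) (series u n.+1 @[n --> \oo])).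
  have := cu; rewrite -(cvg_shiftS (series u)); exact.
have -> : (fun n => series u n.+1) = (fun n => y + B (series u n)).
  apply/funext => n; rewrite /series/= big_nat_recl//= linear_sum/=.
  by congr (_ + _); apply: eq_bigr.
apply: cvgD; first exact: cvg_cst.
exact: (cvg_comp _ _ cu (Bc _)).
Qed.

(** Method of continuity: the resolvent exists at [Z], beyond the norm of [A],
    and a lower bound [c] on the whole segment lets it be continued by steps
    of length [c / 2], each of which is a Neumann series. *)
Lemma resolvent_surjective (V : completeNormedModType R) (A : {linear V -> V})
    (C c z0 Z : R) : (forall x, `|A x| <= C * `|x|) -> C < Z -> 0 < Z ->
  0 < c ->
  (forall z w, z0 <= z <= Z -> c * `|w| <= `|z *: w - A w|) ->
  forall z y, z0 <= z <= Z -> exists w, z *: w - A w = y.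
Proof.
move=> AC CZ Z0 c0 Ac z y zZ.
have [n] : exists n : nat, Z - z <= n%:R * (c / 2).
  exists (Num.bound ((Z - z) / (c / 2))).
  rewrite -ler_pdivrMr ?divr_gt0// ltW//.
  apply: archi_boundP; rewrite divr_ge0 ?divr_ge0 ?(ltW c0)// subr_ge0.
  by case/andP: zZ.
elim: n z y zZ => [|n IH] z y zZ zn.
  have -> : z = Z by lra.
  have [|x|x xE] := @neumann_surjective V (Z^-1 \*: A) (C / Z) _ _ (Z^-1 *: y).
  - by rewrite ltr_pdivrMr ?mul1r.
  - rewrite /= normrZ gtr0_norm ?invr_gt0// [leLHS]mulrC [leRHS]mulrAC.
    by rewrite ler_pM2r ?invr_gt0.
  - exists x; rewrite -[RHS](scalerKV (lt0r_neq0 Z0)) -xE scalerBr/=.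
    by rewrite scalerKV ?gt_eqF.
pose z' := Num.min (z + c / 2) Z.
have z'Z : z0 <= z' <= Z by rewrite /z' le_min ge_min; lra.
have z'n : Z - z' <= n%:R * (c / 2).
  rewrite /z'; have [zc|zc] := leP (z + c / 2) Z; last first.
    by rewrite subrr mulr_ge0// divr_ge0// (ltW c0).
  by move: zn; rewrite -natr1 mulrDl mul1r; lra.
pose A' : {linear V -> V} := (z' \*: idfun) \- A.
have [|v|S [SA AS Sc]] := @bounded_below_inverse V V A' c c0.
- by move=> x; exact: Ac z'Z.
- exact: IH.
have [|x|x xE] := @neumann_surjective V ((z' - z) \*: S) (2^-1) _ _ (S y).
- by lra.
- rewrite /= normrZ ger0_norm; last by rewrite /z' subr_ge0 le_min; lra.
  have z'z : z' - z <= c / 2 by rewrite lerBlDl /z' ge_min lexx.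
  rewrite (le_trans (ler_wpM2r _ z'z))//.
  rewrite (le_trans (ler_wpM2l _ (Sc x))) ?divr_ge0 ?(ltW c0)//.
  suff -> : c / 2 * (c^-1 * `|x|) = 2^-1 * `|x|. by [].
  by field; rewrite gt_eqF.
- exists x; rewrite -[RHS]AS -xE linearB linearZ AS /=.
  by rewrite addrAC -scalerBl opprB addrCA subrr addr0.
Qed.

End BoundedOperators.

(** * Real eigenvalues and the spectral radius *)

Section SpectralRadius.
Context {R : realType} (V : completeNormedModType R) (T : {linear V -> V}).
Variable C : R.
Hypothesis TC : forall x, `|T x| <= C * `|x|.

(** The inverse of [z - T] on [V + iV] is [conj z - T] composed with the
    inverse of the real operator [|z|^2 - 2 Re z T + T^2], which a Neumann
    series provides. *)
Lemma in_resolvent_large (z : R[i]) : 0 <= C ->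
  3 * (C + 1) <= ComplexField.Normc.normc z -> in_resolvent T z.
Proof.
move=> C0; case: z => x y; set N := ComplexField.Normc.normc _ => NC.
have N0 : 0 < N by lra.
have NE : N ^+ 2 = x ^+ 2 + y ^+ 2.
  by rewrite /N /= sqr_sqrtr// addr_ge0// sqr_ge0.
have xN : `|x| <= N by rewrite -sqrtr_sqr ler_wsqrtr// lerDl sqr_ge0.
have T2C v : `|T (T v)| <= C ^+ 2 * `|v|.
  by rewrite (le_trans (TC _))// expr2 -mulrA ler_wpM2l.
pose B : {linear V -> V} :=
  ((2 * x / N ^+ 2) \*: T) \+ ((- (N ^- 2)) \*: (T \o T)).
have Bk v : `|B v| <= 7 / 9 * `|v|.
  rewrite /B /= (le_trans (ler_normD _ _))// [`|_ *: T v|]normrZ [`|_ *: T (T v)|]normrZ.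
  have h1 : `|2 * x / N ^+ 2| * `|T v| <= 2 / 3 * `|v|.
    rewrite normrM normfV [`|N ^+ 2|]ger0_norm ?exprn_ge0 ?(ltW N0)//.
    rewrite normrM ger0_norm//.
    have : 2 * `|x| / N ^+ 2 <= 2 / N.
      rewrite ler_pdivrMr ?exprn_gt0// expr2 mulrA divfK ?gt_eqF//.
      by rewrite ler_wpM2l.
    move=> /(ler_wpM2r (normr_ge0 (T v)))/le_trans; apply.
    rewrite (le_trans (ler_wpM2l _ (TC v))) ?divr_ge0 ?(ltW N0)//.
    rewrite mulrA ler_wpM2r// mulrAC ler_pdivrMr//; lra.
  have h2 : `|- N ^- 2| * `|T (T v)| <= 1 / 9 * `|v|.
    rewrite normrN ger0_norm ?invr_ge0 ?exprn_ge0 ?(ltW N0)//.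
    rewrite (le_trans (ler_wpM2l _ (T2C v))) ?invr_ge0 ?exprn_ge0 ?(ltW N0)//.
    rewrite mulrA ler_wpM2r// ler_pdivrMl ?exprn_gt0//; nra.
  by apply: (le_trans (lerD h1 h2)); rewrite -mulrDl ler_wpM2r//; lra.
pose Q : {linear V -> V} := idfun \- B.
pose X : {linear V -> V} := (x \*: idfun) \- T.
have k1 : 7 / 9 < 1 :> R by lra.
have [||S [SQ QS Sc]] :=
    @bounded_below_inverse _ V V Q (2 / 9) _ _ (neumann_surjective k1 Bk).
- by lra.
- move=> v; rewrite /Q/= (le_trans _ (lerB_dist _ _))//.
  by have := Bk v; lra.
have N20 : N ^+ 2 != 0 by rewrite expf_neq0 ?gt_eqF.
have XXQ v : X (X v) + (y * y) *: v = N ^+ 2 *: Q v.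
  have -> : N ^+ 2 *: Q v = N ^+ 2 *: v - N ^+ 2 *: B v by rewrite -scalerBr.
  have -> : N ^+ 2 *: B v = (2 * x) *: T v - T (T v).
    rewrite /B /= scalerDr !scalerA mulrN mulfV// scaleN1r.
    by rewrite mulrC divfK.
  have -> : X (X v) = x *: (x *: v - T v) - T (x *: v - T v) by [].
  rewrite NE [T (_ - _)]linearB [T (x *: v)]linearZ /= scalerBr scalerA scalerDl -!expr2.
  rewrite [2 * x]mulr_natl mulr2n scalerDl.
  rewrite !opprD !opprK; set a := x ^+ 2 *: v; set b := y ^+ 2 *: v.
  by rewrite [RHS]addrAC -!addrA; congr (a + (_ + (_ + _))); rewrite addrC.
have XQ v : Q (X v) = X (Q v).
  have BT u : B (T u) = T (B u).
    by rewrite /B /= [RHS]linearD; congr (_ + _); rewrite linearZ.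
  have QT u : Q (T u) = T (Q u) by rewrite -[LHS]/(T u - B (T u)) BT -linearB.
  have -> : X v = x *: v - T v by [].
  by rewrite [LHS]linearB [Q (x *: v)]linearZ QT.
have XS v : S (X v) = X (S v) by rewrite -[in LHS](QS v) -XQ SQ.
have XXS v : X (X (S v)) + (y * y) *: S v = N ^+ 2 *: v by rewrite XXQ QS.
have pE w : complex_pencil T (Complex x y) w =
    (X w.1 - y *: w.2, X w.2 + y *: w.1).
  by rewrite /complex_pencil /X/=; congr pair; rewrite addrAC.
pose Z w : V * V := (N ^- 2 *: (X (S w.1) + y *: S w.2),
                     N ^- 2 *: (X (S w.2) - y *: S w.1)).
have Xb v : `|X v| <= (`|x| + C) * `|v|.
  by rewrite mulrDl (le_trans (ler_normB _ _))// normrZ lerD2l.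
clearbody X; have Xc := linear_bound_continuous Xb.
have Scont := linear_bound_continuous Sc.
exists Z; split.
- move=> w.
  have c1 : {for w, continuous (fun w : V * V => S w.1)}.
    by apply: continuous_comp; [exact: cvg_fst|exact: Scont].
  have c2 : {for w, continuous (fun w : V * V => S w.2)}.
    by apply: continuous_comp; [exact: cvg_snd|exact: Scont].
  have d1 : {for w, continuous (fun w : V * V => X (S w.1))}.
    by apply: (continuous_comp c1); exact: Xc.
  have d2 : {for w, continuous (fun w : V * V => X (S w.2))}.
    by apply: (continuous_comp c2); exact: Xc.
  apply: cvg_pair => /=.
    by apply: cvgZr; apply: cvgD => //; apply: cvgZr.
  by apply: cvgZr; apply: cvgB => //; apply: cvgZr.
- have SB a b : S (X a - y *: b) = X (S a) - y *: S b.
    by rewrite linearB linearZ XS.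
  have SD a b : S (X a + y *: b) = X (S a) + y *: S b.
    by rewrite linearD linearZ XS.
  have XB a b : X (a - y *: b) = X a - y *: X b by rewrite linearB linearZ.
  have XD a b : X (a + y *: b) = X a + y *: X b by rewrite linearD linearZ.
  move=> [a b]; rewrite pE /Z [(_, _).1]/= [(_, _).2]/= SB SD XB XD.
  congr pair; rewrite -[RHS](scalerK N20) -XXS; congr (_ *: _).
  + by rewrite scalerDr scalerA addrA subrK.
  + by rewrite scalerBr scalerA opprB addrA addrAC addrK.
- move=> [a b]; rewrite pE /Z [(_, _).1]/= [(_, _).2]/=.
  congr pair; rewrite linearZ /= scalerA mulrC -scalerA.
  + rewrite -scalerBr -[RHS](scalerK N20) -XXS; congr (_ *: _).
    by rewrite linearD linearZ /= scalerBr scalerA opprB addrA addrAC addrK.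
  + rewrite -scalerDr -[RHS](scalerK N20) -XXS; congr (_ *: _).
    by rewrite linearB linearZ /= scalerDr scalerA addrA subrK.
Qed.

Lemma normc_real (z : R) :
  ComplexField.Normc.normc (Complex z 0) = `|z|.
Proof. by rewrite /= expr0n addr0 sqrtr_sqr. Qed.

(** A real eigenvalue kills the injectivity of the pencil; the other half is
    that the spectrum is bounded, so that its supremum is an upper bound. *)
Lemma eigenvalue_le_spectral_radius (z : R) (w : V) :
  w != 0 -> T w = z *: w -> `|z| <= spectral_radius T.
Proof.
move=> w0 Tw; have C0 : 0 <= C.
  have := TC w; rewrite Tw normrZ ler_pM2r ?normr_gt0//.
  exact: le_trans.
apply: ub_le_sup.
  exists (3 * (C + 1)) => _ [z' sz' <-].
  rewrite leNgt; apply/negP => /ltW z'C.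
  by apply: sz'; apply: in_resolvent_large.
exists (Complex z 0); last exact: normc_real.
move=> [S [_ KS _]].
have /(congr1 S) : complex_pencil T (Complex z 0) (w, 0) =
    complex_pencil T (Complex z 0) (0, 0).
  by rewrite /complex_pencil /= !(scale0r, scaler0, Tw, linear0, subr0, addr0) subrr.
by rewrite !KS => -[/eqP]; rewrite (negbTE w0).
Qed.

End SpectralRadius.

(** * Products of Banach spaces *)

Section ProductComplete.
Context {R : realType} (U V : completeNormedModType R).

HB.instance Definition _ := Pointed.on (U * V)%type.

Lemma prod_cauchy_cvg (F : set_system (U * V)) :
  ProperFilter F -> cauchy F -> [cvg F in (U * V)%type].
Proof.
move=> FF /cauchyP Fc.
have c1 : cvg (fst @ F).
  apply/cauchy_cvgP; apply: (@cauchy_exP R U (fst @ F)) => e e0.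
  have [x Fx] := Fc e e0; exists x.1.
  apply: (@filterS _ F _ (ball x e) (fun y => ball x.1 e y.1)) => // y.
  by rewrite -!ball_normE /= prod_normE gt_max => /andP[].
have c2 : cvg (snd @ F).
  apply/cauchy_cvgP; apply: (@cauchy_exP R V (snd @ F)) => e e0.
  have [x Fx] := Fc e e0; exists x.2.
  apply: (@filterS _ F _ (ball x e) (fun y => ball x.2 e y.2)) => // y.
  by rewrite -!ball_normE /= prod_normE gt_max => /andP[].
apply/cvg_ex; exists (lim (fst @ F), lim (snd @ F)).
rewrite -[F]/(id @ F) (_ : id = fun x : U * V => (x.1, x.2)).
  exact: cvg_pair.
by apply/funext => -[].
Qed.

HB.instance Definition _ :=
  Uniform_isComplete.Build (U * V)%type prod_cauchy_cvg.

End ProductComplete.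

(** * Linear and multilinear maps *)

Section LinearFacts.
Context {R : realType} {V W : lmodType R} (f : V -> W).
Hypothesis flin : linear f.

Let g : {linear V -> W} := HB.pack f (GRing.isLinear.Build _ _ _ _ f flin).

Lemma lin0 : f 0 = 0. Proof. exact: (linear0 g). Qed.
Lemma linB x y : f (x - y) = f x - f y. Proof. exact: (linearB g). Qed.
Lemma linD x y : f (x + y) = f x + f y. Proof. exact: (linearD g). Qed.
Lemma linZ (a : R) x : f (a *: x) = a *: f x.
Proof. exact: (linearZ_LR g). Qed.
Lemma lin_sum I r (P : pred I) (F : I -> V) :
  f (\sum_(i <- r | P i) F i) = \sum_(i <- r | P i) f (F i).
Proof. exact: (linear_sum g). Qed.

End LinearFacts.

Section NatMultilinear.
Context {R : realType} {X V : normedModType R}.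

Definition update (v : nat -> X) j x : nat -> X :=
  fun k => if k == j then x else v k.

Definition shift_seq k (v : nat -> X) : nat -> X := fun i => v (k + i)%N.

(** A map of [n] variables is encoded as a map on infinite sequences that
    reads the first [n] entries, so that the product of a map of [k] variables
    with one of [l] shifted variables needs no cast between index types. *)
Definition multilinear_upto n (P : (nat -> X) -> V) : Prop :=
  (forall v w, (forall i, (i < n)%N -> v i = w i) -> P v = P w) /\
  (forall v j a x y, (j < n)%N ->
     P (update v j (a *: x + y)) = a *: P (update v j x) + P (update v j y)).

Lemma shift_update_lt k v j x : (j < k)%N ->
  shift_seq k (update v j x) = shift_seq k v.
Proof.
move=> jk; apply/funext => i; rewrite /shift_seq /update.
by rewrite gtn_eqF// (leq_trans jk)// leq_addr.
Qed.

Lemma shift_update_ge k v j x : (k <= j)%N ->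
  shift_seq k (update v j x) = update (shift_seq k v) (j - k)%N x.
Proof.
move=> kj; apply/funext => i; rewrite /shift_seq /update.
by rewrite -[in LHS](subnKC kj) eqn_add2l.
Qed.

End NatMultilinear.

(** * A quadratic equation with multilinear data *)

Section InverseSquares.
Context {R : realType}.

Definition inv_sqr n : R := (n.+1%:R ^+ 2)^-1.

Lemma inv_sqr_gt0 n : 0 < inv_sqr n.
Proof. by rewrite invr_gt0 exprn_gt0. Qed.

Lemma sum_inv_sqr n : \sum_(1 <= k < n) inv_sqr k <= 1.
Proof.
case: n => [|n]; first by rewrite big_geq.
suff H : \sum_(1 <= k < n.+1) inv_sqr k <= 1 - n.+1%:R^-1.
  by apply: (le_trans H); rewrite gerBl.
elim: n => [|n IH]; first by rewrite big_geq// invr1 subrr.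
rewrite big_nat_recr//= (le_trans (lerD IH (lexx _)))//.
rewrite /inv_sqr -addrA lerD2l -subr_ge0.
have n1 : 0 < n.+1%:R :> R by [].
have -> : n.+2%:R = n.+1%:R + 1 :> R by rewrite -[n.+2]addn1 natrD.
set a := n.+1%:R in n1 *.
have -> : - (a + 1)^-1 - (- a^-1 + (((a + 1) ^+ 2)^-1)) =
   (a * (a + 1) ^+ 2)^-1.
  by field; rewrite !gt_eqF//; lra.
by rewrite invr_ge0 mulr_ge0 ?exprn_ge0//; lra.
Qed.

Lemma inv_sqr_mul k l :
  inv_sqr k * inv_sqr l <= 2 * (inv_sqr k + inv_sqr l) * inv_sqr (k + l)%N.
Proof.
rewrite /inv_sqr; have k1 : 0 < k.+1%:R :> R by [].
have l1 : 0 < l.+1%:R :> R by [].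
have -> : (k + l).+1%:R = k.+1%:R + l.+1%:R - 1 :> R.
  by rewrite -[(k + l).+1]addn1 -[k.+1]addn1 -[l.+1]addn1 !natrD; ring.
have : 1 <= k.+1%:R :> R by rewrite ler1n.
have : 1 <= l.+1%:R :> R by rewrite ler1n.
move: (k.+1%:R : R) (l.+1%:R : R) k1 l1 => a b a0 b0 b1 a1.
have ab0 : 0 < a + b - 1 by lra.
have -> : 2 * ((a ^+ 2)^-1 + (b ^+ 2)^-1) * ((a + b - 1) ^+ 2)^-1 =
  (a ^+ 2)^-1 * (b ^+ 2)^-1 * (2 * (a ^+ 2 + b ^+ 2) / (a + b - 1) ^+ 2).
  by field; rewrite !gt_eqF.
rewrite ler_peMr ?mulr_ge0 ?invr_ge0 ?sqr_ge0// ler_pdivlMr ?exprn_gt0// mul1r.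
have : 0 <= (a - b) ^+ 2 by exact: sqr_ge0.
nra.
Qed.

(** The weights [1 / (n + 1) ^ 2] are, up to a constant, stable under
    convolution: this is what lets a quadratic recursion be bounded by a
    geometric sequence. *)
Lemma convolution_inv_sqr n :
  \sum_(1 <= k < n) inv_sqr k * inv_sqr (n - k)%N <= 4 * inv_sqr n.
Proof.
have le2 : \sum_(1 <= k < n) inv_sqr (n - k)%N <= 1.
  case: n => [|n]; first by rewrite big_geq.
  rewrite big_nat_rev/= add1n.
  rewrite (eq_big_nat _ _ (F2 := fun i => inv_sqr i)) ?sum_inv_sqr//.
  by move=> i /andP[i1 i2]; rewrite subSS subnBA ?(ltnW i2)// addnC addnK.
have : \sum_(1 <= k < n) inv_sqr k * inv_sqr (n - k)%N <=
   \sum_(1 <= k < n) 2 * (inv_sqr k + inv_sqr (n - k)%N) * inv_sqr n.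
  rewrite !big_nat; apply: ler_sum => k /andP[k1 kn].
  by rewrite (le_trans (inv_sqr_mul _ _))// subnKC// ltnW.
move=> /le_trans; apply.
rewrite -mulr_suml -mulr_sumr big_split/= ler_pM2r ?inv_sqr_gt0//.
have := sum_inv_sqr n; lra.
Qed.

Lemma inv_sqr_expr4 n : (0 < n)%N -> (4 ^+ n)^-1 <= inv_sqr n.
Proof.
move=> n0; rewrite /inv_sqr lef_pV2 ?posrE ?exprn_gt0//.
rewrite -!natrX ler_nat -[4%N]/(2 ^ 2)%N -expnM mulnC expnM leq_exp2r//.
exact: ltn_expl.
Qed.

End InverseSquares.

Section QuadraticEquation.
Context {R : realType} {X : normedModType R} {V : completeNormedModType R}.
Variables (s : nat -> (nat -> X) -> V) (C : V -> V -> V) (Q c : R).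
Hypothesis s0 : forall v, s 0%N v = 0.
Hypothesis s_multi : forall n, multilinear_upto n (s n).
Hypothesis s_bound : forall n v, `|s n v| <= Q * \prod_(i < n) `|v i|.
Hypothesis Cl : forall y, linear (C^~ y).
Hypothesis Cr : forall x, linear (C x).
Hypothesis c_ge0 : 0 <= c.
Hypothesis C_bound : forall x y, `|C x y| <= c * `|x| * `|y|.

(** The coefficient of degree [n] of the solution depends on those of smaller
    degree. This is Picard iteration with [N] as fuel: the value no longer
    depends on [N] once [n <= N]. *)
Fixpoint picard (N n : nat) (v : nat -> X) : V :=
  if N is N'.+1 then
    if n == 0%N then 0 else
    s n v + \sum_(1 <= k < n) C (picard N' k v) (picard N' (n - k)%N (shift_seq k v))
  else 0.

Definition coef n := picard n n.

Lemma picard_stable N N' n v : (n <= N)%N -> (n <= N')%N ->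
  picard N n v = picard N' n v.
Proof.
elim: N N' n v => [|N IH] [|N'] [|n] v //= nN nN'.
by congr (_ + _); apply: eq_big_nat => k /andP[k1 kn]; congr C; apply: IH; lia.
Qed.

Lemma coef0 v : coef 0 v = 0. Proof. by []. Qed.

Lemma coefE n v : (0 < n)%N -> coef n v =
  s n v + \sum_(1 <= k < n) C (coef k v) (coef (n - k)%N (shift_seq k v)).
Proof.
case: n => // n _; rewrite {1}/coef /=; congr (_ + _).
apply: eq_big_nat => k /andP[k1 kn].
by rewrite /coef; congr C; apply: picard_stable; lia.
Qed.

Lemma coef_multilinear n : multilinear_upto n (coef n).
Proof.
elim/ltn_ind: n => -[_|n IH]; first by split=> // v j a x y; rewrite ltn0.
split=> [v w vw|v j a x y jn]; rewrite !coefE//.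
  congr (_ + _); first exact: (s_multi _).1.
  apply: eq_big_nat => k /andP[k1 kn]; congr C.
    by apply: (IH _ kn).1 => i ik; apply: vw; rewrite (ltn_trans ik).
  apply: (IH _ _).1; first by rewrite ltn_subrL k1.
  by move=> i ik; apply: vw; rewrite -ltn_subRL.
rewrite (s_multi _).2// scalerDr scaler_sumr addrACA -big_split/=.
congr (_ + _); apply: eq_big_nat => k /andP[k1 kn].
have [jk|kj] := ltnP j k.
  by rewrite !shift_update_lt// (IH _ kn).2// Cl.
have jE z : coef k (update v j z) = coef k v.
  apply: (IH _ kn).1 => i ik; rewrite /update ltn_eqF//.
  exact: leq_trans kj.
rewrite !jE !shift_update_ge//.
rewrite (IH _ _).2 ?Cr ?ltn_subrL ?k1//.
by rewrite ltn_sub2r// (leq_trans kn).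
Qed.

(* [D] is so small that the quadratic term, which contributes [4 * c * D ^ 2],
   stays below [D / 2]; then [rho] is so large that the source stays below the
   other half. *)
Let D := (16 * (c + 1))^-1.
Let rho := 4 * (1 + 2 * Num.max Q 0 / D).

Let D_gt0 : 0 < D.
Proof. by rewrite invr_gt0; have := c_ge0; lra. Qed.

Let cD : c * D <= 1 / 16.
Proof.
rewrite /D ler_pdivrMr; have := c_ge0; lra.
Qed.

Let rho_gt0 : 0 < rho.
Proof.
rewrite /rho mulr_gt0// ltr_pwDl// divr_ge0 ?(ltW D_gt0)//.
by rewrite mulr_ge0// le_max lexx orbT.
Qed.

Let Q_rho n : (0 < n)%N -> Q <= D / 2 * rho ^+ n * inv_sqr n.
Proof.
move=> n0; set Q0 := Num.max Q 0.
have QQ0 : Q <= Q0 by rewrite le_max lexx.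
have Q00 : 0 <= Q0 by rewrite le_max lexx orbT.
pose b := 1 + 2 * Q0 / D.
have b1 : 1 <= b by rewrite lerDl divr_ge0 ?(ltW D_gt0)// mulr_ge0.
have bn : b <= b ^+ n by rewrite ler_eXnr.
have Qb : Q <= D / 2 * b.
  rewrite /b mulrDr mulr1 (_ : D / 2 * _ = Q0); last first.
    by field; rewrite gt_eqF.
  by have := D_gt0; lra.
have h4 : 1 <= 4 ^+ n * inv_sqr n :> R.
  have := inv_sqr_expr4 (R := R) n0.
  by rewrite -(ler_pM2l (x := 4 ^+ n)) ?exprn_gt0// mulfV// expf_neq0.
suff bw : b <= rho ^+ n * inv_sqr n.
  apply: (le_trans Qb); rewrite -[leRHS]mulrA ler_wpM2l// divr_ge0//.
  exact: ltW D_gt0.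
rewrite (_ : rho = 4 * b)// exprMn mulrAC.
rewrite (le_trans bn)// ler_peMl// exprn_ge0//; lra.
Qed.

Lemma coef_bound_weighted n v :
  `|coef n v| <= D * rho ^+ n * inv_sqr n * \prod_(i < n) `|v i|.
Proof.
elim/ltn_ind: n v => -[_|n IH] v.
  rewrite coef0 normr0 big_ord0 mulr1 expr0 mulr1 mulr_ge0 ?(ltW D_gt0)//.
  exact: ltW (inv_sqr_gt0 _).
rewrite coefE//; set p := \prod_(i < n.+1) _.
have p0 : 0 <= p by rewrite prodr_ge0.
have h1 : `|s n.+1 v| <= D / 2 * rho ^+ n.+1 * inv_sqr n.+1 * p.
  by rewrite (le_trans (s_bound _ _))// ler_wpM2r// Q_rho.
have h2 : `|\sum_(1 <= k < n.+1) C (coef k v) (coef (n.+1 - k)%N (shift_seq k v))|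
    <= D / 2 * rho ^+ n.+1 * inv_sqr n.+1 * p.
  apply: (le_trans (ler_norm_sum _ _ _)).
  apply: (@le_trans _ _ (\sum_(1 <= k < n.+1)
      (c * D ^+ 2 * rho ^+ n.+1 * p) * (inv_sqr k * inv_sqr (n.+1 - k)%N))).
    rewrite !big_nat; apply: ler_sum => k /andP[k1 kn].
    apply: (le_trans (C_bound _ _)).
    have a1 := IH k kn v.
    have a2 := IH (n.+1 - k)%N _ (shift_seq k v).
    rewrite -mulrA (le_trans (ler_wpM2l c_ge0 (ler_pM _ _ a1 (a2 _))))//.
      by rewrite ltn_subrL k1.
    rewrite [leLHS](_ : _ = c * D ^+ 2 * (rho ^+ k * rho ^+ (n.+1 - k)%N) *
      ((\prod_(i < k) `|v i|) * \prod_(i < (n.+1 - k)%N) `|shift_seq k v i|) *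
      (inv_sqr k * inv_sqr (n.+1 - k)%N)); last by ring.
    rewrite -exprD subnKC ?(ltnW kn)//.
    suff -> : (\prod_(i < k) `|v i|) * (\prod_(i < (n.+1 - k)%N) `|shift_seq k v i|) = p
      by [].
    rewrite /p -!(big_mkord xpredT (fun i => `|v i|)) [RHS](big_cat_nat (n := k)) ?(ltnW kn)//=.
    congr (_ * _).
    rewrite -[X in \prod_(X <= _ < _) _]add0n big_addn big_mkord.
    by apply: eq_bigr => i _; rewrite /shift_seq addnC.
  rewrite -mulr_sumr.
  have h := convolution_inv_sqr (R := R) n.+1.
  have E0 : 0 <= c * D ^+ 2 * rho ^+ n.+1 * p.
    by rewrite !mulr_ge0// ?exprn_ge0// ltW.
  apply: (le_trans (ler_wpM2l E0 h)).
  rewrite [leLHS](_ : _ = (c * D) * (4 * D * rho ^+ n.+1 * inv_sqr n.+1 * p)); last by ring.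
  have F0 : 0 <= 4 * D * rho ^+ n.+1 * inv_sqr n.+1 * p.
    by rewrite !mulr_ge0// ?exprn_ge0// ltW// inv_sqr_gt0.
  apply: (le_trans (ler_wpM2r F0 cD)).
  rewrite [leRHS](_ : _ = 1 / 8 * (4 * D * rho ^+ n.+1 * inv_sqr n.+1 * p)); last by field.
  by rewrite ler_wpM2r//; lra.
apply: (le_trans (ler_normD _ _)); apply: (le_trans (lerD h1 h2)).
by rewrite le_eqVlt; apply/orP; left; apply/eqP; field.
Qed.

Lemma coef_bound n v : `|coef n v| <= D * rho ^+ n * \prod_(i < n) `|v i|.
Proof.
apply: (le_trans (coef_bound_weighted n v)).
rewrite ler_wpM2r ?prodr_ge0// ler_piMr ?mulr_ge0 ?exprn_ge0 ?(ltW D_gt0) ?(ltW rho_gt0)//.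
by rewrite invf_le1 ?exprn_gt0// exprn_ege1// ler1n.
Qed.

Definition diag_coef (H : X) (n : nat) : V := coef n (fun=> H).

Lemma diag_coef_bound H n : `|diag_coef H n| <= D * (rho * `|H|) ^+ n.
Proof.
apply: (le_trans (coef_bound _ _)).
by rewrite /= prodr_const card_ord (exprMn n rho) mulrA.
Qed.

Lemma cauchy_product (x : nat -> V) N :
  \sum_(0 <= n < N) \sum_(0 <= k < n.+1) C (x k) (x (n - k)%N) =
  \sum_(0 <= k < N) C (x k) (\sum_(0 <= j < N - k) x j).
Proof.
elim: N => [|N IH]; first by rewrite !big_geq.
rewrite big_nat_recr//= IH [in RHS]big_nat_recr//= subSnn big_nat1.
rewrite [X in _ + X]big_nat_recr//= subnn addrA; congr (_ + _).
rewrite -big_split/=; apply: eq_big_nat => k /andP[_ kN].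
by rewrite subSn ?(ltnW kN)// big_nat_recr//= (linD (Cr _)).
Qed.

Lemma geometric_tail (t : R) N M : 0 <= t <= 1 / 4 ->
  \sum_(N <= n < M) t ^+ n <= 2 * t ^+ N.
Proof.
move=> /andP[t0 t1]; have tn k : 0 <= t ^+ k by exact: exprn_ge0.
have [NM|MN] := leqP N M; last by rewrite big_geq ?mulr_ge0// ltnW.
suff : \sum_(N <= n < M) t ^+ n <= 2 * t ^+ N - 2 * t ^+ M.
  by have := tn M; lra.
rewrite -(subnKC NM); elim: (M - N)%N => [|k IH].
  by rewrite addn0 big_geq// subrr.
rewrite addnS big_nat_recr ?leq_addr//= exprS.
by have := tn (N + k)%N; nra.
Qed.

(** The solution of [x = S + C x x] is a power series in [H] when [S] is one:
    its coefficients are determined degree by degree and grow geometrically.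
    The sum solves the equation because the partial sums fail to do so only by
    the part of the Cauchy product above the diagonal, which tends to [0]. *)
Theorem quadratic_equation_solution :
  exists (a : nat -> (nat -> X) -> V) (K rho : R),
  [/\ 0 < K, 0 < rho, forall n, multilinear_upto n (a n),
      forall n v, `|a n v| <= K * rho ^+ n * \prod_(i < n) `|v i| &
      (forall v, a 0%N v = 0 /\ a 1%N v = s 1%N v) /\
      forall H S, rho * `|H| <= 1 / 4 ->
        (fun N => \sum_(0 <= n < N) s n (fun=> H)) @ \oo --> S ->
        exists x, x = S + C x x /\ forall N,
          `|x - \sum_(0 <= n < N) a n (fun=> H)| <= K * (rho * `|H|) ^+ N].
Proof.
have D0 := D_gt0; have rho0 := rho_gt0.
exists coef, (2 * D), rho; split.
- by rewrite mulr_gt0.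
- exact: rho0.
- exact: coef_multilinear.
- move=> n v; apply: (le_trans (coef_bound n v)).
  rewrite ler_wpM2r ?prodr_ge0// ler_wpM2r ?exprn_ge0 ?(ltW rho0)//; lra.
split=> [v|H S].
  by rewrite coef0 coefE// big_geq// addr0.
set t := rho * `|H| => t4 HS.
have t0 : 0 <= t by rewrite mulr_ge0 ?(ltW rho0).
have t04 : 0 <= t <= 1 / 4 by rewrite t0.
have tn k : 0 <= t ^+ k by exact: exprn_ge0.
pose x_ := diag_coef H; pose X_ := series x_.
have xb n : `|x_ n| <= D * t ^+ n := diag_coef_bound H n.
have XX N M : (N <= M)%N -> `|X_ M - X_ N| <= 2 * D * t ^+ N.
  move=> NM; rewrite /X_ /series /= (big_cat_nat (n := N))//= [_ + _ - _]addrC addKr.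
  apply: (le_trans (ler_norm_sum _ _ _)).
  apply: (@le_trans _ _ (\sum_(N <= n < M) D * t ^+ n)); first by apply: ler_sum => i _; exact: xb.
  rewrite -mulr_sumr mulrAC mulrC ler_wpM2r ?(ltW D0)//.
  exact: geometric_tail.
have cX : cvgn X_.
  apply: normed_cvg; apply: (@series_le_cvg _ _ (fun n => D * t ^+ n)).
  - by move=> n /=.
  - by move=> n; rewrite mulr_ge0// ltW.
  - by move=> n; exact: xb.
  - have := @is_cvg_geometric_series _ D t.
    by rewrite ger0_norm//; apply; lra.
pose x := limn X_.
have xX N : `|x - X_ N| <= 2 * D * t ^+ N.
  have h : (fun M => `|X_ M - X_ N|) @ \oo --> `|x - X_ N|.
    by apply: cvg_norm; apply: cvgB; [exact: cX|exact: cvg_cst].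
  apply: (ler_cvg_to h (cvg_cst _)).
  by near=> M; apply: XX; near: M; exact: nbhs_infty_ge.
exists x; split; last exact: xX.
have X0 : X_ 0%N = 0 by rewrite /X_ /series /= big_geq.
have xD : `|x| <= 2 * D by have := xX 0%N; rewrite X0 subr0 expr0 mulr1.
have XD N : `|X_ N| <= 2 * D.
  by have := XX 0%N N (leq0n _); rewrite X0 subr0 expr0 mulr1.
have tN N : t ^+ N <= (1 / 2) ^+ N by rewrite lerXn2r ?nnegrE//; lra.
pose S_ N := \sum_(0 <= n < N) s n (fun=> H).
have XE N : X_ N - S_ N - C (X_ N) (X_ N) =
    - \sum_(0 <= k < N) C (x_ k) (X_ N - X_ (N - k)%N).
  have -> : X_ N - S_ N = \sum_(0 <= k < N) C (x_ k) (X_ (N - k)%N).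
    rewrite -[RHS]cauchy_product /X_ /S_ /series /= -sumrB.
    apply: eq_big_nat => -[|n] _.
      by rewrite big_nat1 /x_ /diag_coef !coef0 s0 subrr (lin0 (Cr _)).
    rewrite /x_ /diag_coef coefE// addrC addKr [RHS]big_nat_recr//= [X in _ = X + _]big_ltn//.
    by rewrite subnn !coef0 (lin0 (Cr _)) (lin0 (Cl _)) add0r addr0.
  rewrite -[in C (X_ N)]/(X_ N) {1}/X_ /series /=.
  rewrite (lin_sum (Cl _)) -sumrB -sumrN; apply: eq_bigr => k _.
  by rewrite (linB (Cr (x_ k))) opprB.
have XEb N : `|X_ N - S_ N - C (X_ N) (X_ N)| <= 2 * c * D ^+ 2 * (1 / 2) ^+ N.
  rewrite XE normrN; apply: (le_trans (ler_norm_sum _ _ _)).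
  apply: (@le_trans _ _ (\sum_(0 <= k < N) 2 * c * D ^+ 2 * t ^+ N)).
    apply: ler_sum_nat => k /andP[_ kN].
    apply: (le_trans (C_bound _ _)).
    rewrite -mulrA (le_trans (ler_wpM2l c_ge0 (ler_pM _ _ (xb k) (XX _ _ (leq_subr _ _)))))//.
    rewrite -[in leRHS](subnKC (ltnW kN)) exprD.
    by rewrite le_eqVlt; apply/orP; left; apply/eqP; ring.
  rewrite sumr_const_nat subn0 -[_ *+ N]mulr_natr -[leLHS]mulrA ler_wpM2l//.
    by rewrite !mulr_ge0// ltW.
  have NN : N%:R <= 2 ^+ N :> R by rewrite -natrX ler_nat ltnW// ltn_expl.
  apply: (le_trans (ler_wpM2l (tn N) NN)); rewrite -exprMn lerXn2r ?nnegrE//; lra.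
have CC N : `|C (X_ N) (X_ N) - C x x| <= 8 * c * D ^+ 2 * (1 / 2) ^+ N.
  have -> : C (X_ N) (X_ N) - C x x = C (X_ N) (X_ N - x) + C (X_ N - x) x.
    by rewrite (linB (Cr _)) (linB (Cl _)) addrA subrK.
  have h : `|X_ N - x| <= 2 * D * (1 / 2) ^+ N.
    rewrite distrC (le_trans (xX N))// ler_wpM2l ?tN// mulr_ge0// ltW//.
  apply: (le_trans (ler_normD _ _)).
  have h1 : `|C (X_ N) (X_ N - x)| <= c * (2 * D) * (2 * D * (1 / 2) ^+ N).
    by rewrite (le_trans (C_bound _ _))// ler_pM// ?mulr_ge0// ler_wpM2l.
  have h2 : `|C (X_ N - x) x| <= c * (2 * D * (1 / 2) ^+ N) * (2 * D).
    by rewrite (le_trans (C_bound _ _))// ler_pM// ?mulr_ge0// ler_wpM2l.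
  apply: (le_trans (lerD h1 h2)).
  by rewrite le_eqVlt; apply/orP; left; apply/eqP; field.
apply/eqP; rewrite -subr_eq0 -normr_le0.
pose g N := (2 * D + 2 * c * D ^+ 2 + 8 * c * D ^+ 2) * (1 / 2) ^+ N + `|S_ N - S|.
have g0 : g @ \oo --> 0.
  rewrite -[0 in X in _ --> X]addr0 -{2}(normr0 V) -(subrr S); apply: cvgD.
    have := @cvg_geometric R (2 * D + 2 * c * D ^+ 2 + 8 * c * D ^+ 2) (1 / 2).
    by apply; rewrite ger0_norm; lra.
  by apply: cvg_norm; apply: cvgB; [exact: HS|exact: cvg_cst].
apply: (ler_cvg_to (cvg_cst _) g0).
near=> N; rewrite /g.
  have -> : x - (S + C x x) = (x - X_ N) + (X_ N - S_ N - C (X_ N) (X_ N)) +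
     (C (X_ N) (X_ N) - C x x) + (S_ N - S).
    have -> : x - X_ N + (X_ N - S_ N - C (X_ N) (X_ N)) =
        x - S_ N - C (X_ N) (X_ N) by rewrite !addrA subrK.
    rewrite [x - S_ N - _ + (_ - _)]addrA subrK addrA [x - S_ N - _]addrAC subrK.
    by rewrite opprD addrA addrAC.
  apply: (le_trans (ler_normD _ _)); rewrite lerD2r.
  rewrite (mulrDl (2 * D + _)) (mulrDl (2 * D)).
  apply: (le_trans (ler_normD _ _)); rewrite lerD//.
  apply: (le_trans (ler_normD _ _)); rewrite lerD//.
  by rewrite (le_trans (xX N))// ler_wpM2l ?tN// mulr_ge0// ltW.
Unshelve. all: by end_near. Qed.

End QuadraticEquation.

(** * Functions with a power series expansion *)

Section PowerSeriesExpansion.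
Context {R : realType} {X W : normedModType R}.
Variables (F : X -> W) (a : X) (P : nat -> (nat -> X) -> W) (B : nat -> R).
Variables (K rho : R).
Hypothesis P_multi : forall n, multilinear_upto n (P n).
Hypothesis P_bound : forall n v, `|P n v| <= B n * \prod_(i < n) `|v i|.
Hypothesis rho_gt0 : 0 < rho.
Hypothesis P_approx : forall h, rho * `|h| <= 1 / 4 -> forall N,
  `|F (a + h) - \sum_(0 <= n < N) P n (fun=> h)| <= K * (rho * `|h|) ^+ N.

(** The default value [0] is never read by a map of [n] variables. *)
Definition extend n (v : 'I_n -> X) : nat -> X :=
  fun k => if insub k is Some i then v i else 0.

Lemma extend_ord n (v : 'I_n -> X) (i : 'I_n) : extend v i = v i.
Proof. by rewrite /extend valK. Qed.

(** [P n] need not be symmetric. Summing over all permutations makes it so and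
    multiplies its diagonal values by [n!], which the factor [1 / n!] of the
    power series cancels. *)
Definition symmetrize n (v : 'I_n -> X) : W :=
  \sum_(t : 'S_n) P n (extend (v \o t)).

Lemma symmetrize_diag n h :
  symmetrize (fun _ : 'I_n => h) = n`!%:R *: P n (fun=> h).
Proof.
rewrite /symmetrize (eq_bigr (fun=> P n (fun=> h))) => [|t _].
  by rewrite sumr_const card_Sn scaler_nat.
apply: (P_multi n).1 => i ilt.
by rewrite (extend_ord _ (Ordinal ilt)).
Qed.

Lemma symmetrize_multilinear n : multilinear_map (@symmetrize n).
Proof.
move=> v j b u w upd; rewrite /symmetrize scaler_sumr -big_split/=.
apply: eq_bigr => t _.
have E x : P n (extend (upd x \o t)) =
    P n (update (extend (v \o t)) (t^-1%g j) x).
  apply: (P_multi n).1 => i ilt; rewrite (extend_ord _ (Ordinal ilt)).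
  rewrite /update /upd /= (extend_ord _ (Ordinal ilt)) /=.
  rewrite -[(i == _)%N]/(Ordinal ilt == (t^-1)%g j).
  by rewrite (can2_eq (permK t) (permKV t)).
by rewrite !E (P_multi n).2.
Qed.

Lemma symmetrize_symmetric n : symmetric_map (@symmetrize n).
Proof.
move=> v t; rewrite /symmetrize [RHS](reindex_inj (mulIg t)) /=.
apply: eq_bigr => t' _; congr (P n (extend _)).
by apply/funext => i; rewrite /= permM.
Qed.

Lemma symmetrize_bounded n : bounded_map (@symmetrize n).
Proof.
exists (n`!%:R * B n) => v.
apply: (le_trans (ler_norm_sum _ _ _)).
apply: (@le_trans _ _ (\sum_(t : 'S_n) B n * \prod_(k < n) `|v k|)).
  apply: ler_sum => t _; apply: (le_trans (P_bound _ _)).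
  rewrite [in leRHS](reindex_inj (@perm_inj _ t)).
  by rewrite (eq_bigr (fun i => `|v (t i)|)) // => i _; rewrite extend_ord.
by rewrite sumr_const card_Sn -[leLHS]mulr_natl mulrA.
Qed.

Let small (h : X) : `|h| < (4 * rho)^-1 -> rho * `|h| <= 1 / 4.
Proof.
move=> hr; rewrite mulrC -ler_pdivlMr// ltW//.
by rewrite (lt_le_trans hr)// invfM mul1r.
Qed.

Lemma power_series_analytic : analytic_at F a.
Proof.
exists symmetrize; split=> [n|].
  split; [exact: symmetrize_multilinear|exact: symmetrize_symmetric|].
  exact: symmetrize_bounded.
exists (4 * rho)^-1; split; first by rewrite invr_gt0 mulr_gt0.
move=> U /uniform_nbhs[E [entE EU]].
have [e /= e0 eE] : exists2 e : R, 0 < e & [set xy | ball xy.1 e xy.2] `<=` E.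
  by move: entE; rewrite -entourage_ballE => -[e e0 eE]; exists e.
have K4 : (fun N => K * (1 / 4) ^+ N) @ \oo --> (0 : R).
  by apply: cvg_geometric; rewrite ger0_norm; lra.
have K0 : 0 <= K.
  have := @P_approx 0; rewrite normr0 mulr0 => /(_ _ 0%N).
  rewrite expr0 mulr1 => /(_ _)/(le_trans (normr_ge0 _)); apply; lra.
near=> N; apply: EU => h /=.
rewrite -ball_normE /= sub0r normrN => hr; apply: eE => /=.
rewrite -ball_normE /=.
have -> : \sum_(i < N) i`!%:R^-1 *: symmetrize (fun _ : 'I_i => h) =
    \sum_(0 <= n < N) P n (fun=> h).
  rewrite big_mkord; apply: eq_bigr => i _.
  by rewrite symmetrize_diag scalerK// pnatr_eq0 -lt0n fact_gt0.
apply: (le_lt_trans (P_approx (small hr) N)).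
apply: (@le_lt_trans _ _ (K * (1 / 4) ^+ N)).
  rewrite ler_wpM2l// lerXn2r ?nnegrE ?mulr_ge0 ?(ltW rho_gt0)//.
  exact: small.
apply: le_lt_trans (ler_norm _) _.
near: N; move/cvgr0Pnorm_lt : K4; exact.
Unshelve. all: by end_near. Qed.

Lemma power_series_differentiable :
  differentiable F a /\ forall h, 'd F a h = P 1%N (fun=> h).
Proof.
have lin1 : linear (fun h => P 1%N (fun=> h)).
  move=> b u w.
  have E x : P 1%N (fun=> x) = P 1%N (update (fun=> 0) 0 x).
    by apply: (P_multi 1).1 => -[|].
  by rewrite !E (P_multi 1).2.
pose df : {linear X -> W} := HB.pack (fun h => P 1%N (fun=> h))
  (GRing.isLinear.Build _ _ _ _ (fun h => P 1%N (fun=> h)) lin1).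
have dfc : continuous df.
  apply: (@linear_bound_continuous _ _ _ df (B 1%N)) => x.
  by apply: (le_trans (P_bound _ _)); rewrite big_ord1.
have FaE : F a = P 0%N (fun=> 0).
  apply/eqP; rewrite -subr_eq0 -normr_le0.
  have := @P_approx 0; rewrite normr0 mulr0 addr0 => /(_ _ 1%N).
  by rewrite big_nat1 expr1 mulr0; apply; lra.
have expansion : F \o shift a = cst (F a) + df +o_ 0 id.
  apply/eqaddoP => e e0; near=> h.
  have hr : rho * `|h| <= 1 / 4.
    apply: small; near: h.
    by apply: nbhs0_lt; rewrite invr_gt0 mulr_gt0.
  have := P_approx hr 2; rewrite big_nat_recr// big_nat1 /=.
  have -> : P 0%N (fun=> h) = F a by rewrite FaE; apply: (P_multi 0).1.
  have -> : (F \o shift a - (cst (F a) + df)) h =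
      F (a + h) - (F a + P 1%N (fun=> h)) by rewrite [a + h]addrC.
  move=> /le_trans; apply; rewrite expr2 !mulrA ler_wpM2r//.
  rewrite mulrAC -!mulrA mulrA mulrC.
  have : `|h| <= e / (`|K * rho ^+ 2| + 1).
    near: h; apply: nbhs0_le; rewrite divr_gt0// ltr_pwDr//.
  rewrite ler_pdivlMr ?ltr_pwDr//; apply: le_trans.
  rewrite mulrDr mulr1 -[leLHS]addr0 lerD//.
  have := ler_norm (K * rho ^+ 2); rewrite expr2; have := normr_ge0 h; nra.
have dE := diff_unique dfc expansion.
split; last by move=> h; rewrite dE.
by apply/diff_locallyP; rewrite dE.
Unshelve. all: by end_near. Qed.

End PowerSeriesExpansion.

(** * The Banach algebra of Hoelder functions *)

Section HoelderAlgebra.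
Context {R : realType} {M : pointedMetricType R} {alpha : R}.
Local Notation V := (hoelder_space M alpha).
Implicit Types g k : V.

Lemma hoelder_normE g : `|g| = sup_norm g + hoelder_const alpha g.
Proof. by []. Qed.

Lemma sup_norm_ge0 g : 0 <= sup_norm g.
Proof. exact: le_trans (sup_norm_ub g point). Qed.

Lemma le_norm_eval g x : `|g x| <= `|g|.
Proof.
by rewrite (le_trans (sup_norm_ub g x))// hoelder_normE lerDl hoelder_const_ge0.
Qed.

Lemma sup_norm_le_norm g : sup_norm g <= `|g|.
Proof. by rewrite hoelder_normE lerDl hoelder_const_ge0. Qed.

Lemma hoelder_const_le_norm g : hoelder_const alpha g <= `|g|.
Proof. by rewrite hoelder_normE lerDr sup_norm_ge0. Qed.

Lemma hoelder_increment g x y :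
  `|g x - g y| <= hoelder_const alpha g * mdist x y `^ alpha.
Proof.
have [->|xy] := eqVneq x y.
  by rewrite subrr normr0 mulr_ge0 ?hoelder_const_ge0 ?powR_ge0.
by rewrite -ler_pdivrMr ?powR_gt0 ?mdist_gt0// hoelder_const_ub.
Qed.

Lemma hoelder_const_le_increment (u : M -> R) (C : R) : 0 <= C ->
  (forall x y, `|u x - u y| <= C * mdist x y `^ alpha) ->
  hoelder_const alpha u <= C.
Proof.
move=> C0 uC; apply: hoelder_const_le => // x y xy.
by rewrite ler_pdivrMr ?powR_gt0 ?mdist_gt0.
Qed.

Lemma hoelder_norm_le g (a b : R) : 0 <= b -> (forall x, `|g x| <= a) ->
  (forall x y, `|g x - g y| <= b * mdist x y `^ alpha) -> `|g| <= a + b.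
Proof.
move=> b0 ga gb; rewrite hoelder_normE lerD//; first exact: sup_norm_le.
exact: hoelder_const_le_increment.
Qed.

Lemma evalD g k x : (g + k) x = g x + k x. Proof. by []. Qed.
Lemma evalB g k x : (g - k) x = g x - k x. Proof. by []. Qed.
Lemma evalZ (a : R) g x : (a *: g) x = a * g x. Proof. by []. Qed.

Lemma eval_sum I (r : seq I) (P : pred I) (F : I -> V) x :
  (\sum_(i <- r | P i) F i) x = \sum_(i <- r | P i) F i x.
Proof. by elim/big_rec2: _ => // i y z _ <-. Qed.

Lemma eval_linear x : linear (fun g => g x : R^o).
Proof. by []. Qed.

Lemma eval_continuous x : continuous (fun g => g x : R^o).
Proof.
pose e : {linear V -> R^o} := HB.pack (fun g => g x : R^o)
  (GRing.isLinear.Build _ _ _ _ (fun g => g x : R^o) (eval_linear x)).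
apply: (@linear_bound_continuous _ _ _ e 1) => g.
by rewrite mul1r; exact: le_norm_eval.
Qed.

Lemma hoelder_ext g k : (forall x, g x = k x) -> g = k.
Proof. by move=> gk; apply/val_inj/funext. Qed.

(** A Cauchy filter converges pointwise; the bounds of order [0] and [alpha]
    on the differences pass to the pointwise limit. *)
Lemma hoelder_cauchy_cvg (F : set_system V) :
  ProperFilter F -> cauchy F -> [cvg F in V].
Proof.
move=> FF Fc.
have close (e : R) : 0 < e -> exists u0 : V, F [set u | `|u - u0| <= e].
  move=> e0; have [u0 Fu0] := (cauchyP F).1 Fc e e0.
  exists u0; apply: filterS Fu0 => u.
  by rewrite -ball_normE /= distrC => /ltW.
have evc x : cvg ((fun u : V => u x : R^o) @ F).
  apply/cauchy_cvgP; apply: (@cauchy_exP R R^o) => e e0.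
  have [u0 Fu0] := close (e / 2) ltac:(by rewrite divr_gt0).
  exists (u0 x); apply: (@filterS _ F _ [set u | `|u - u0| <= e / 2]) => // u.
  rewrite /= => uu0; rewrite -ball_normE /= distrC -evalB.
  by rewrite (le_lt_trans (le_norm_eval _ _))// (le_lt_trans uu0)//; lra.
pose l x : R := lim ((fun u : V => u x : R^o) @ F).
have ev x : (fun u : V => u x : R^o) @ F --> (l x : R^o) by exact: evc.
have lsup (u0 : V) e : F [set u | `|u - u0| <= e] ->
    forall x, `|l x - u0 x| <= e.
  move=> Fe x; have h : (fun u : V => `|u x - u0 x|) @ F --> `|l x - u0 x|.
    by apply: cvg_norm; apply: cvgB; [exact: ev|exact: cvg_cst].
  apply: (ler_cvg_to h (cvg_cst e)); apply: filterS Fe => u /= ue.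
  by rewrite -evalB (le_trans (le_norm_eval _ _)).
have linc (u0 : V) e : F [set u | `|u - u0| <= e] ->
    forall x y, `|(l x - u0 x) - (l y - u0 y)| <= e * mdist x y `^ alpha.
  move=> Fe x y.
  have h : (fun u : V => `|(u x - u0 x) - (u y - u0 y)|) @ F -->
      `|(l x - u0 x) - (l y - u0 y)|.
    apply: cvg_norm; apply: cvgB; apply: cvgB;
      by [exact: ev|exact: cvg_cst].
  apply: (ler_cvg_to h (cvg_cst _)); apply: filterS Fe => u /= ue.
  rewrite -!evalB (le_trans (hoelder_increment _ _ _))//.
  by rewrite ler_wpM2r ?powR_ge0// (le_trans (hoelder_const_le_norm _)).
have lH : Defs.hoelder alpha l.
  have [u0 Fu0] := close 1 ltr01; have [C [C1 C2]] := hoelderP u0.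
  exists (1 + C); split=> [x|x y].
    rewrite -[l x](subrK (u0 x)) (le_trans (ler_normD _ _))// lerD//.
    exact: lsup.
  have -> : l x - l y = ((l x - u0 x) - (l y - u0 y)) + (u0 x - u0 y) by ring.
  rewrite (le_trans (ler_normD _ _))// mulrDl lerD//; exact: linc.
pose L : V := HoelderSpace (asboolT lH : l \in hoelder_pred alpha).
apply/cvg_ex; exists L; apply/cvgrPdist_le => e e0.
have e2 : 0 < e / 2 by rewrite divr_gt0.
have e4 : 0 < e / 4 by rewrite divr_gt0.
have [u0 Fu0] := close (e / 4) e4.
apply: filterS (Fu0) => u uu0.
have Lu0 : `|L - u0| <= e / 4 + e / 4.
  apply: hoelder_norm_le; first exact: ltW.
  - by move=> x; exact: lsup.
  - by move=> x y; exact: linc.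
have -> : L - u = (L - u0) - (u - u0) by rewrite opprB addrA subrK.
by rewrite (le_trans (ler_normB _ _))// (le_trans (lerD Lu0 uu0))//; lra.
Qed.

HB.instance Definition _ := Uniform_isComplete.Build V hoelder_cauchy_cvg.

Lemma hoelder_one : Defs.hoelder alpha (fun _ : M => 1).
Proof.
by exists 1; split=> [x|x y]; rewrite ?normr1// subrr normr0 mul1r powR_ge0.
Qed.

Definition hone : V :=
  HoelderSpace (asboolT hoelder_one : _ \in hoelder_pred alpha).

Lemma honeE x : hone x = 1. Proof. by []. Qed.

Lemma norm_hone : `|hone| <= 1.
Proof.
rewrite -[leRHS]addr0; apply: hoelder_norm_le => // [x|x y]; first by rewrite normr1.
by rewrite /= subrr normr0 mul0r.
Qed.

Lemma mul_increment g k x y : `|g x * k x - g y * k y| <=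
  (sup_norm g * hoelder_const alpha k + sup_norm k * hoelder_const alpha g) *
    mdist x y `^ alpha.
Proof.
have -> : g x * k x - g y * k y = g x * (k x - k y) + k y * (g x - g y) by ring.
rewrite (le_trans (ler_normD _ _))// !normrM mulrDl -!mulrA lerD//.
  by rewrite ler_pM ?sup_norm_ub ?hoelder_increment.
by rewrite ler_pM ?sup_norm_ub ?hoelder_increment.
Qed.

Lemma hoelder_mul g k : Defs.hoelder alpha (fun x => g x * k x).
Proof.
have sg := sup_norm_ge0 g; have sk := sup_norm_ge0 k.
have cg := hoelder_const_ge0 g; have ck := hoelder_const_ge0 k.
exists (sup_norm g * sup_norm k +
  (sup_norm g * hoelder_const alpha k + sup_norm k * hoelder_const alpha g)).
split=> [x|x y].
  rewrite normrM (@le_trans _ _ (sup_norm g * sup_norm k))//.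
    by rewrite ler_pM ?sup_norm_ub.
  by rewrite lerDl addr_ge0// mulr_ge0.
rewrite (le_trans (mul_increment g k x y))// ler_wpM2r ?powR_ge0//.
by rewrite lerDr mulr_ge0.
Qed.

Definition hmul g k : V :=
  HoelderSpace (asboolT (hoelder_mul g k) : _ \in hoelder_pred alpha).

Lemma hmulE g k x : hmul g k x = g x * k x. Proof. by []. Qed.

Lemma norm_hmul g k : `|hmul g k| <= `|g| * `|k|.
Proof.
have sg := sup_norm_ge0 g; have sk := sup_norm_ge0 k.
have cg := hoelder_const_ge0 g; have ck := hoelder_const_ge0 k.
apply: (@le_trans _ _ (sup_norm g * sup_norm k +
  (sup_norm g * hoelder_const alpha k + sup_norm k * hoelder_const alpha g))).
  apply: hoelder_norm_le.
  - by rewrite addr_ge0// mulr_ge0.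
  - by move=> x; rewrite normrM ler_pM ?sup_norm_ub.
  - exact: mul_increment.
by rewrite !hoelder_normE; nra.
Qed.

Lemma hmul_linearl k : linear (hmul^~ k).
Proof.
move=> a u v; apply: hoelder_ext => x.
by rewrite hmulE !evalD !evalZ !hmulE; ring.
Qed.

Lemma hmul_linearr g : linear (hmul g).
Proof.
move=> a u v; apply: hoelder_ext => x.
by rewrite hmulE !evalD !evalZ !hmulE; ring.
Qed.

Fixpoint hprod n (v : nat -> V) : V :=
  if n is n'.+1 then hmul (hprod n' v) (v n') else hone.

Lemma norm_hprod n v : `|hprod n v| <= \prod_(i < n) `|v i|.
Proof.
elim: n => [|n IH] /=; first by rewrite big_ord0 norm_hone.
by rewrite big_ord_recr/= (le_trans (norm_hmul _ _))// ler_wpM2r.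
Qed.

Lemma hprod_multilinear n : multilinear_upto n (hprod n).
Proof.
elim: n => [|n [IH1 IH2]] /=; first by split.
split=> [v w vw|v j a x y].
  by rewrite vw// (IH1 v w)// => i ilt; apply: vw; exact: ltnW.
rewrite ltnS leq_eqVlt => /predU1P[->|jn].
  have E z : hprod n (update v n z) = hprod n v.
    by apply: IH1 => i ilt; rewrite /update ltn_eqF.
  by rewrite !E /update eqxx hmul_linearr.
rewrite IH2//.
have E z : update v j z n = v n by rewrite /update gtn_eqF.
by rewrite !E hmul_linearl.
Qed.

Lemma hprod_cst n H x : hprod n (fun=> H) x = H x ^+ n.
Proof.
elim: n => [|n IH]; first by rewrite expr0.
by rewrite -[LHS]/(hprod n (fun=> H) x * H x) IH exprSr.
Qed.

Definition hexp_coeff (H : V) n : V := n`!%:R^-1 *: hprod n (fun=> H).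

Lemma norm_hexp_coeff H n : `|hexp_coeff H n| <= exp_coeff `|H| n.
Proof.
rewrite /hexp_coeff /exp_coeff /= normrZ mulrC ger0_norm ?invr_ge0//.
rewrite ler_wpM2r ?invr_ge0//.
by rewrite (le_trans (norm_hprod _ _))// prodr_const card_ord.
Qed.

Lemma cvg_hexp_series H : cvgn (series (hexp_coeff H)).
Proof.
apply: normed_cvg; apply: (@series_le_cvg _ _ (exp_coeff `|H|)).
- by move=> n /=.
- by move=> n; rewrite /exp_coeff /= divr_ge0// exprn_ge0.
- by move=> n; exact: norm_hexp_coeff.
- exact: is_cvg_series_exp_coeff.
Qed.

(** Defining the exponential by its series in the Banach algebra, rather than
    pointwise, gives at once its power series expansion in the Hoelder norm. *)
Definition hexp H : V := limn (series (hexp_coeff H)).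

Lemma hexpE H x : hexp H x = expR (H x).
Proof.
have h1 : (fun n => series (hexp_coeff H) n x : R^o) @ \oo --> (hexp H x : R^o).
  exact: (cvg_comp _ _ (cvg_hexp_series (H := H)) (@eval_continuous x _)).
have h2 : (fun n => series (hexp_coeff H) n x : R^o) =
    series (exp_coeff (H x)).
  apply/funext => n; rewrite /series /= eval_sum; apply: eq_bigr => i _.
  by rewrite /hexp_coeff evalZ hprod_cst mulrC.
by rewrite /expR -(cvg_lim _ h1)// h2.
Qed.

Lemma norm_hexpB1 H : `|H| <= 1 / 4 -> `|hexp H - hone| <= 2 * `|H|.
Proof.
move=> H4.
have h : (fun n => `|series (hexp_coeff H) n - hone|) @ \oo -->
    `|hexp H - hone|.
  apply: cvg_norm; apply: cvgB; [exact: cvg_hexp_series|exact: cvg_cst].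
apply: (ler_cvg_to h (cvg_cst _)); near=> n.
have n0 : (0 < n)%N by near: n; exact: nbhs_infty_gt.
rewrite /series /= big_ltn//.
have -> : hexp_coeff H 0 = hone by rewrite /hexp_coeff /= invr1 scale1r.
rewrite addrC addKr (le_trans (ler_norm_sum _ _ _))//.
rewrite -[X in _ <= 2 * X]expr1; apply: le_trans (@geometric_tail R _ 1 n _); last first.
  by rewrite normr_ge0.
apply: ler_sum => i _; rewrite (le_trans (norm_hexp_coeff _ _))//.
rewrite /exp_coeff /= ler_piMr ?exprn_ge0// invf_le1//.
by rewrite ler1n fact_gt0.
Unshelve. all: by end_near. Qed.

End HoelderAlgebra.

(** * Fredholm alternative from a Lasota-Yorke inequality *)

Lemma ultra_fmap (T U : Type) (f : T -> U) (F : set_system T) :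
  UltraFilter F -> UltraFilter (f @ F).
Proof.
move=> FU; have FF : ProperFilter F by exact: ultra_proper.
split; first exact: fmap_proper_filter.
move=> G GG sFG; apply/seteqP; split=> A; last exact: sFG.
move=> GA; have [//|FA] := in_ultra_setVsetC (f @^-1` A) FU.
have /(filterI GA) : G (~` A) by exact: sFG.
by rewrite setICr => /filter_not_empty.
Qed.

Section LasotaYorke.
Context {R : realType} {M : pointedMetricType R} {alpha : R}.
Hypothesis M_compact : compact [set: M].
Hypothesis alpha_gt0 : 0 < alpha.
Local Notation V := (hoelder_space M alpha).

Lemma near_dist_powR (x : M) (e : R) : 0 < e ->
  \forall y \near x, mdist x y `^ alpha <= e.
Proof.
move=> e0; have r0 : 0 < e `^ alpha^-1 by exact: powR_gt0.
apply: filterS (nbhsx_ballx x _ r0) => y; rewrite ballEmdist /= => xy.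
have -> : e = (e `^ alpha^-1) `^ alpha.
  by rewrite -powRrM mulVf ?gt_eqF// powRr1// ltW.
by rewrite ge0_ler_powR ?nnegrE ?mdist_ge0 ?powR_ge0 ?(ltW alpha_gt0)// ltW.
Qed.

(** Arzela-Ascoli: along an ultrafilter a bounded sequence converges
    pointwise, and compactness of the space turns the common modulus of
    continuity into uniform convergence. *)
Lemma hoelder_ball_ultra_cvg (U : set_system nat) (w_ : nat -> V) :
  UltraFilter U -> (forall n, `|w_ n| <= 1) ->
  exists w : V, (fun n => sup_norm (w_ n - w)) @ U --> (0 : R).
Proof.
move=> UU w1; have UF : ProperFilter U by exact: ultra_proper.
have evc x : exists l : R, (fun n => w_ n x) @ U --> l.
  have := @segment_compact R (-1) 1; rewrite compact_ultra.
  have UI := ultra_fmap (fun n => w_ n x) UU.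
  move=> /(_ _ UI) [|l [_ ul]]; last by exists l.
  apply: (@filterS _ U _ setT); last exact: filterT.
  move=> n _; rewrite /= in_itv /= -ler_norml.
  exact: le_trans (le_norm_eval _ _) (w1 n).
have [l lE] := choice evc.
have winc n x y : `|w_ n x - w_ n y| <= mdist x y `^ alpha.
  rewrite (le_trans (hoelder_increment _ _ _))// ler_piMl ?powR_ge0//.
  exact: le_trans (hoelder_const_le_norm _) (w1 n).
have linc x y : `|l x - l y| <= mdist x y `^ alpha.
  have h : (fun n => `|w_ n x - w_ n y|) @ U --> `|l x - l y|.
    by apply: cvg_norm; apply: cvgB; exact: lE.
  by apply: (ler_cvg_to h (cvg_cst _)); apply: nearW => n; exact: winc.
have lsup x : `|l x| <= 1.
  have h : (fun n => `|w_ n x|) @ U --> `|l x| by apply: cvg_norm; exact: lE.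
  apply: (ler_cvg_to h (cvg_cst _)); apply: nearW => n.
  exact: le_trans (le_norm_eval _ _) (w1 n).
have lH : Defs.hoelder alpha l.
  by exists 1; split=> // x y; rewrite mul1r.
exists (HoelderSpace (asboolT lH : l \in hoelder_pred alpha)).
apply/cvgr0Pnorm_le => e e0.
have e3 : 0 < e / 3 by rewrite divr_gt0.
have /compact_near_coveringP/(_ nat U
    (fun n x => `|w_ n x - l x| <= e) _) := M_compact.
have cover x : [set: M] x ->
    \forall x' \near x & n \near U, `|w_ n x' - l x'| <= e.
  move=> _; exists ([set y | mdist x y `^ alpha <= e / 3],
                    [set n | `|w_ n x - l x| <= e / 3]).
    split; first exact: near_dist_powR.
    by move/cvgrPdist_le : (lE x) => /(_ _ e3); apply: filterS => n; rewrite distrC.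
  move=> [y n] [/= xy wl].
  have -> : w_ n y - l y = (w_ n y - w_ n x) + (w_ n x - l x) + (l x - l y) by ring.
  rewrite (le_trans (ler_normD _ _))// (_ : e = e / 3 + e / 3 + e / 3); last by field.
  rewrite lerD ?(le_trans (linc _ _))// (le_trans (ler_normD _ _))// lerD//.
  by rewrite distrC (le_trans (winc _ _ _)).
move=> /(_ cover); apply: filterS => n wn.
rewrite ger0_norm ?sup_norm_ge0//; apply: sup_norm_le => x; exact: wn.
Qed.

Lemma hoelder_le_norm_increment (g : V) x y :
  `|g x - g y| <= `|g| * mdist x y `^ alpha.
Proof.
rewrite (le_trans (hoelder_increment _ _ _))// ler_wpM2r ?powR_ge0//.
exact: hoelder_const_le_norm.
Qed.

Lemma sup_normD (g k : V) : sup_norm (g + k) <= sup_norm g + sup_norm k.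
Proof.
apply: sup_norm_le => x; rewrite (le_trans (ler_normD _ _))//.
by rewrite lerD// sup_norm_ub.
Qed.

Lemma sup_normZ (a : R) (g : V) : sup_norm (a *: g) <= `|a| * sup_norm g.
Proof.
by apply: sup_norm_le => x; rewrite evalZ normrM ler_wpM2l// sup_norm_ub.
Qed.

Lemma sup_norm_eq0 (g : V) : sup_norm g <= 0 -> g = 0.
Proof.
move=> g0; apply: hoelder_ext => x; apply/eqP; rewrite -normr_le0.
exact: le_trans (sup_norm_ub g x) g0.
Qed.

(** Quasi-compactness in the form of a Fredholm alternative. A Lasota-Yorke
    inequality makes [T] a contraction of the Hoelder seminorm up to the sup
    norm; a sequence of almost eigenvectors converges in sup norm, its limit
    is an eigenvector, hence [0], and then the inequality kills the Hoelder
    seminorms as well. *)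
Lemma lasota_yorke_bounded_below (T : {linear V -> V}) (a C z1 Z : R) :
  0 <= C -> a < z1 -> 0 < z1 ->
  (forall g, sup_norm (T g) <= C * sup_norm g) ->
  (forall g, hoelder_const alpha (T g) <=
     a * hoelder_const alpha g + C * sup_norm g) ->
  (forall z w, z1 <= z <= Z -> T w = z *: w -> w = 0) ->
  exists2 c : R, 0 < c & forall z w, z1 <= z <= Z -> c * `|w| <= `|z *: w - T w|.
Proof.
move=> C0 az1 z10 Tsup Thoel Tinj; apply: contrapT => /forall2NP nc.
have /choice[zw zwP] : forall n : nat, exists zw : R * V,
    [/\ z1 <= zw.1 <= Z, `|zw.2| = 1 & `|zw.1 *: zw.2 - T zw.2| <= n.+1%:R^-1].
  move=> n; have [[]|] := nc n.+1%:R^-1.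
    by rewrite invr_gt0.
  move=> /existsNP[z /existsNP[w /not_implyP[zZ /negP]]]; rewrite -ltNge => zw.
  have w0 : `|w| != 0.
    apply: contraTN zw => /eqP w0; move: (w0) => /eqP; rewrite normr_eq0 => /eqP ->.
    by rewrite normr0 mulr0 ltNge normr_ge0.
  exists (z, `|w|^-1 *: w); split => //=.
    by rewrite normrZ normfV normr_id mulVf.
  rewrite [T (_ *: w)]linearZ/= scalerA mulrC -scalerA -scalerBr normrZ normfV normr_id.
  by rewrite ler_pdivrMl ?lt0r ?w0 ?normr_ge0// mulrC ltW.
pose z_ n := (zw n).1; pose w_ n := (zw n).2.
have zZ n : z1 <= z_ n <= Z by have [] := zwP n.
have w1 n : `|w_ n| = 1 by have [] := zwP n.
have w1le n : `|w_ n| <= 1 by rewrite w1.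
pose r_ n := `|z_ n *: w_ n - T (w_ n)|.
have rn n : r_ n <= n.+1%:R^-1 by have [] := zwP n.
have [U [UU Uoo]] := @ultraFilterLemma nat \oo _.
have UF : ProperFilter U by exact: ultra_proper.
have r0 : r_ @ U --> (0 : R).
  have r00 : r_ @ \oo --> (0 : R).
    apply: (@squeeze_cvgr _ _ _ _ (fun=> 0) (fun n => n.+1%:R^-1)).
    - by apply: nearW => n; rewrite rn normr_ge0.
    - exact: cvg_cst.
    - exact: cvg_harmonic.
  by move=> A /r00 /Uoo.
have [w s0] := hoelder_ball_ultra_cvg UU w1le.
have [z [zI zU]] : exists z, (z1 <= z <= Z) /\ z_ @ U --> z.
  have := @segment_compact R z1 Z; rewrite compact_ultra.
  have UI := ultra_fmap z_ UU.
  move=> /(_ _ UI) [|z [zZ' ul]]; last first.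
    by exists z; split => //; move: zZ'; rewrite /= in_itv.
  by apply: (@filterS _ U _ setT); [move=> n _; rewrite /= in_itv /=|exact: filterT].
pose s_ n := sup_norm (w_ n - w).
have wz : z *: w - T w = 0.
  apply: sup_norm_eq0.
  (* [b n] bounds the sup norm of [z *: w - T w] and tends to [0] along [U]. *)
  pose b n := `|z| * s_ n + `|z - z_ n| + r_ n + C * s_ n.
  have b0 : b @ U --> `|z| * 0 + `|z - z| + 0 + C * 0.
    apply: cvgD; last by apply: cvgMr.
    apply: cvgD => //; apply: cvgD; first exact: cvgMr.
    by apply: cvg_norm; apply: cvgB => //; exact: cvg_cst.
  rewrite (_ : 0 = `|z| * 0 + `|z - z| + 0 + C * 0); last first.
    by rewrite subrr normr0 !mulr0 !addr0.
  apply: (ler_cvg_to (cvg_cst _) b0); apply: nearW => n.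
  have -> : z *: w - T w = - z *: (w_ n - w) + (z - z_ n) *: w_ n +
      (z_ n *: w_ n - T (w_ n)) + T (w_ n - w).
    rewrite [T (w_ n - w)]linearB/= addrA -[_ + _ + T (w_ n)]addrA subrK.
    rewrite scalerBl -[_ + _ + z_ n *: w_ n]addrA subrK.
    by rewrite scaleNr scalerBr opprB subrK.
  apply: (le_trans (sup_normD _ _)); apply: lerD; last exact: Tsup.
  apply: (le_trans (sup_normD _ _)); apply: lerD; last exact: sup_norm_le_norm.
  apply: (le_trans (sup_normD _ _)); apply: lerD.
    by rewrite (le_trans (sup_normZ _ _))// normrN.
  rewrite (le_trans (sup_normZ _ _))// ler_piMr// -(w1 n).
  exact: sup_norm_le_norm.
have w0 : w = 0.
  by apply: (Tinj z) => //; apply/eqP; rewrite eq_sym -subr_eq0 wz.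
pose u_ n := sup_norm (w_ n).
have u0 : u_ @ U --> (0 : R).
  by move: s0; rewrite w0; under eq_fun do rewrite subr0.
have : z1 - a <= 0.
  (* The Hoelder constant of [w_ n] is [1 - u_ n], so that the inequality for
     [T (w_ n)] reads [(z1 - a) * (1 - u_ n) <= C * u_ n + r_ n]. *)
  pose b n := (z1 - a) * u_ n + C * u_ n + r_ n.
  have b0 : b @ U --> (z1 - a) * 0 + C * 0 + 0.
    by apply: cvgD => //; apply: cvgD; apply: cvgMr.
  rewrite !mulr0 !addr0 in b0.
  apply: (ler_cvg_to (cvg_cst _) b0); apply: nearW => n.
  have cE : hoelder_const alpha (w_ n) = 1 - u_ n.
    by rewrite -(w1 n) hoelder_normE addrC addKr.
  have z_0 : 0 < z_ n by have /andP[z1n _] := zZ n; exact: lt_le_trans z1n.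
  have Tc := Thoel (w_ n); rewrite -/(u_ n) in Tc.
  have Tn0 := hoelder_const_ge0 (T (w_ n)).
  have rn0 : 0 <= r_ n by exact: normr_ge0.
  have : hoelder_const alpha (w_ n) <=
      (a * hoelder_const alpha (w_ n) + C * u_ n + r_ n) / z_ n.
    apply: hoelder_const_le_increment => [|x y].
      by rewrite divr_ge0 ?(ltW z_0)//; lra.
    rewrite mulrAC ler_pdivlMr// -[z_ n in leLHS]gtr0_norm// -normrM mulrC.
    have -> : z_ n * (w_ n x - w_ n y) = ((z_ n *: w_ n - T (w_ n)) x -
       (z_ n *: w_ n - T (w_ n)) y) + (T (w_ n) x - T (w_ n) y).
      by rewrite !evalB !evalZ; ring.
    rewrite (le_trans (ler_normD _ _))// addrC mulrDl lerD//.
      by rewrite (le_trans (hoelder_increment _ _ _))// ler_wpM2r ?powR_ge0.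
    exact: hoelder_le_norm_increment.
  rewrite ler_pdivlMr// cE.
  have /andP[z1n _] := zZ n.
  have u1 : 0 <= 1 - u_ n by rewrite -cE hoelder_const_ge0.
  rewrite /b; nra.
by rewrite leNgt subr_gt0 az1.
Qed.

End LasotaYorke.

(** * Matching the fibres of nearby points *)

Section Preimages.
Context {R : realType} {M : pointedMetricType R}.
Variables (f : M -> M) (p : nat).
Hypothesis f_lhomeo : local_homeomorphism f.
Hypothesis f_degree : has_degree f p.

Lemma local_homeomorphism_open (y : M) (O : set M) :
  nbhs y O -> nbhs (f y) (f @` O).
Proof.
move=> yO; have [U [g [[oU Uy] oV gK _ cg]]] := f_lhomeo y.
have Vfy : (f @` U) (f y) by exists y.
have cgy : {for f y, continuous g}.
  by move: cg; rewrite continuous_open_subspace// => /(_ (f y)); apply; rewrite inE.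
have /cgy : nbhs (g (f y)) (O `&` U).
  by rewrite gK ?inE//; apply: filterI => //; exact: open_nbhs_nbhs.
have := open_nbhs_nbhs (conj oV Vfy).
apply: filterS2 => z [u Uu <-] /=; rewrite gK ?inE// => -[Ou _].
by exists u.
Qed.

Definition enumerates_fibre (u : 'I_p -> M) (x : M) : Prop :=
  injective u /\ f @^-1` [set x] = range u.

Lemma fibre_enumeration x : exists u, enumerates_fibre u x.
Proof.
have /card_set_bijP[u [uf ui us]] := card_esym (f_degree x).
exists (fun i => u (nat_of_ord i)); split=> [i j uij|].
  by apply/val_inj/ui => //; rewrite inE /=.
apply/seteqP; split=> [z fz|_ [i _ <-]]; last by apply: uf => /=.
have [k /= kp <-] := us _ fz; by exists (Ordinal kp).
Qed.

(** [p] distinct preimages are all of them. *)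
Lemma injective_enumerates_fibre (u : 'I_p -> M) x :
  injective u -> (forall i, f (u i) = x) -> enumerates_fibre u x.
Proof.
move=> ui fu; split => //; apply/seteqP; split=> [z fz|_ [i _ <-]]; last exact: fu.
have [v [vi vE]] := fibre_enumeration x.
have vP i : exists j, v j = u i.
  have : (f @^-1` [set x]) (u i) by exact: fu.
  by rewrite vE => -[j _ <-]; exists j.
have [s sE] := choice vP.
have si : injective s by move=> i j sij; apply: ui; rewrite -!sE sij.
move: fz; rewrite vE => -[k _ <-].
by exists ((invF si) k) => //; rewrite -sE f_invF.
Qed.

Lemma fsum_fibre (u : 'I_p -> M) x (F : M -> R) : enumerates_fibre u x ->
  \sum_(y \in f @^-1` [set x]) F y = \sum_(i < p) F (u i).
Proof.
move=> [ui ->].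
have -> : range u = [set` codom u].
  apply/seteqP; split=> [_ [i _ <-]|z /=]; first by rewrite /= codom_f.
  by move=> /codomP[i ->]; exists i.
rewrite -fsbig_seq; first by rewrite big_image /=.
by rewrite /codom map_inj_uniq ?enum_uniq.
Qed.

Variables (Lf : M -> R) (A : set M) (sigma L : R) (q : nat).
Hypothesis f_lip : inverse_branch_lipschitz f Lf.
Hypothesis f_H1 : hyp_H1 Lf A sigma L.
Hypothesis f_H2 : hyp_H2 f A q.

Definition branch_rate (B : {set 'I_p}) i : R := if i \in B then L else sigma^-1.

(** The set [B] collects the inverse branches that need not contract. *)
Definition matched_fibres (x x' : M) : Prop :=
  exists (u v : 'I_p -> M) (B : {set 'I_p}),
  [/\ enumerates_fibre u x, enumerates_fibre v x', (#|B| <= q)%N &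
      forall i, mdist (u i) (v i) <= branch_rate B i * mdist x x'].

(** A domain of injectivity contains at most one point of each fibre, and [q]
    of them cover [A]. *)
Lemma card_fibre_bad (y : 'I_p -> M) x : enumerates_fibre y x ->
  (#|[set i | `[< A (y i) >]]%SET| <= q)%N.
Proof.
move=> [yi yE]; set B := [set i | _]%SET.
have [UU [_ UUi _ [QQ [QQU QQq AQ]]]] := f_H2.
have /card_set_bijP[b [bf bi _]] := QQq.
have fy i : f (y i) = x.
  have : range y (y i) by exists i.
  by rewrite -yE.
have cover i : exists O, i \in B -> QQ O /\ O (y i).
  have [iB|iB] := boolP (i \in B); last by exists set0.
  by move: iB; rewrite inE => /asboolP/AQ[D QD Dy]; exists D.
have [D OP] := choice cover.
have inj : {in B &, injective (fun i => b (D i))}.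
  move=> i j iB jB bij; have [Qi Oi] := OP i iB; have [Qj Oj] := OP j jB.
  have OE : D i = D j by apply: bi; rewrite ?inE.
  have [_ injO] := UUi _ (QQU _ Qi).
  by apply: yi; apply: injO; rewrite ?inE ?fy//= OE.
rewrite cardE -(size_map (fun i => b (D i))) -(size_iota 0 q).
apply: uniq_leq_size.
  by rewrite map_inj_in_uniq ?enum_uniq// => i j; rewrite !mem_enum; exact: inj.
move=> _ /mapP[i iB ->]; rewrite mem_enum in iB; rewrite mem_iota add0n /=.
by have [Qi _] := OP i iB; exact: (bf _ Qi).
Qed.

(** Around each preimage [y i] of [x0] take the domain of an inverse branch and
    keep its points closer to [y i] than to the other preimages, so that these
    sets are disjoint. Their images are neighbourhoods of [x0], and a
    point of all these images has exactly one preimage in each set. The rate of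
    a branch is decided by whether its centre [y i] lies in [A]. *)
Lemma matched_fibres_near (x0 : M) :
  exists2 N, nbhs x0 N & forall x x', N x -> N x' -> matched_fibres x x'.
Proof.
have [y yE] := fibre_enumeration x0; have [yi yr] := yE.
have fy i : f (y i) = x0.
  have : range y (y i) by exists i.
  by rewrite -yr.
have /choice[Ug UgP] : forall i, exists Ug : set M * (M -> M),
    [/\ nbhs (y i) Ug.1, {in Ug.1, cancel f Ug.2} &
      forall a b, (f @` Ug.1) a -> (f @` Ug.1) b ->
        mdist (Ug.2 a) (Ug.2 b) <= Lf (y i) * mdist a b].
  by move=> i; have [U [g h]] := f_lip (y i); exists (U, g).
pose D i := [set z | forall j, j != i -> mdist z (y i) < mdist z (y j)].
have nD i : nbhs (y i) (D i).
  apply: filter_forall => j; have [->|ji] := eqVneq j i; first exact: nearW.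
  have d0 : 0 < mdist (y i) (y j) / 2.
    by rewrite divr_gt0// mdist_gt0; apply: contra_neq ji => /yi.
  apply: filterS (nbhsx_ballx (y i) _ d0) => z; rewrite ballEmdist /= => iz _.
  have := metric_triangle (y i) z (y j); rewrite [mdist z (y i)]metric_sym; lra.
pose O i := (Ug i).1 `&` D i.
exists [set x | forall i, (f @` O i) x].
  apply: filter_forall => i; rewrite -(fy i).
  apply: local_homeomorphism_open; apply: filterI => //.
  by have [] := UgP i.
have branch x : (forall i, (f @` O i) x) ->
    forall i, (O i) ((Ug i).2 x) /\ f ((Ug i).2 x) = x.
  move=> xO i; have [z Oz <-] := xO i; have [_ gK _] := UgP i.
  by rewrite gK ?inE//; case: Oz.
have enum x : (forall i, (f @` O i) x) ->
    enumerates_fibre (fun i => (Ug i).2 x) x.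
  move=> xO; apply: injective_enumerates_fibre => [i j ij|i].
    apply: contrapT => /eqP nij.
    have nji : j != i by rewrite eq_sym.
    have h1 := (branch x xO i).1.2 j nji; have h2 := (branch x xO j).1.2 i nij.
    by move: h2; rewrite -ij => /(lt_trans h1); rewrite ltxx.
  by have [] := branch x xO i.
move=> x x' /= xO x'O.
exists (fun i => (Ug i).2 x), (fun i => (Ug i).2 x'), [set i | `[< A (y i) >]]%SET.
split; [exact: enum|exact: enum|exact: card_fibre_bad yE|move=> i].
have sub z : (f @` O i) z -> (f @` (Ug i).1) z.
  by move=> [w [Uw _] <-]; exists w.
have [_ _ lip] := UgP i.
apply: (le_trans (lip _ _ (sub _ (xO i)) (sub _ (x'O i)))).
rewrite ler_wpM2r ?mdist_ge0// /branch_rate inE.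
have [H1A H1nA] := f_H1.
by case: asboolP => [/H1A|/H1nA/ltW].
Qed.

Hypothesis M_compact : compact [set: M].

(** The Lebesgue number of the cover by the neighbourhoods of the previous
    lemma. *)
Lemma matched_fibres_uniform : exists2 delta : R, 0 < delta &
  forall x x', mdist x x' < delta -> matched_fibres x x'.
Proof.
have /compact_near_coveringP/(_ R (0^'+)
  (fun d x => forall x', mdist x x' < d -> matched_fibres x x') _) := M_compact.
case=> [x0 _|d /= d0 dP].
  have [N /nbhs_ballP[r /= r0 rN] NP] := matched_fibres_near x0.
  have r2 : 0 < r / 2 by rewrite divr_gt0.
  exists (ball x0 (r / 2), [set d | d < r / 2]).
    by split; [exact: nbhsx_ballx|exact: nbhs_right_lt].
  move=> [x d] /= [x0x dr] x' xx'; move: x0x; rewrite ballEmdist /= => x0x.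
  apply: NP; apply: rN; rewrite ballEmdist /=; first by lra.
  by rewrite (le_lt_trans (metric_triangle _ x _))//; lra.
exists (d / 2); first by rewrite divr_gt0.
move=> x x' xx'; apply: (dP (d / 2)) => //=; last by rewrite divr_gt0.
by rewrite sub0r normrN gtr0_norm ?divr_gt0//; lra.
Qed.

End Preimages.

(** * The transfer operator on Hoelder functions *)

Section Transfer.
Context {R : realType} {M : pointedMetricType R}.
Variables (f : M -> M) (p q : nat) (sigma L alpha delta : R).
Hypothesis f_degree : has_degree f p.
Hypothesis sigma_gt1 : 1 < sigma.
Hypothesis L_ge1 : 1 <= L.
Hypothesis q_le_p : (q <= p)%N.
Hypothesis alpha_gt0 : 0 < alpha.
Hypothesis delta_gt0 : 0 < delta.
Hypothesis matched : forall x x',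
  mdist x x' < delta -> matched_fibres f p sigma L q x x'.
Local Notation V := (hoelder_space M alpha).
Implicit Types phi g : V.

(** The factor by which the sum over matched preimages of
    [distance ^ alpha] can grow. *)
Definition total_rate : R :=
  (p%:R - q%:R) * sigma `^ (- alpha) + q%:R * L `^ alpha.

Lemma branch_rate_gt0 B i : 0 < branch_rate (p := p) sigma L B i.
Proof.
rewrite /branch_rate; case: ifP => _; first by have := L_ge1; lra.
by rewrite invr_gt0; have := sigma_gt1; lra.
Qed.

Lemma sum_branch_rate (B : {set 'I_p}) : (#|B| <= q)%N ->
  \sum_(i < p) branch_rate sigma L B i `^ alpha <= total_rate.
Proof.
move=> Bq; rewrite (bigID (fun i => i \in B))/=.
have s0 : 0 < sigma by have := sigma_gt1; lra.
have sE : sigma `^ (- alpha) = sigma^-1 `^ alpha.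
  by rewrite -mulN1r powRrM powR_inv1 ?(ltW s0).
have sL : sigma `^ (- alpha) <= L `^ alpha.
  have s1 : sigma^-1 <= 1 by rewrite invf_le1// ltW.
  rewrite sE ge0_ler_powR ?nnegrE ?invr_ge0 ?(ltW s0) ?(ltW alpha_gt0)//.
    by have := L_ge1; lra.
  by have := L_ge1; lra.
have -> : \sum_(i < p | i \in B) branch_rate sigma L B i `^ alpha =
    L `^ alpha *+ #|B|.
  rewrite -sumr_const; apply: eq_bigr => i iB.
  by rewrite /branch_rate iB.
have -> : \sum_(i < p | i \notin B) branch_rate sigma L B i `^ alpha =
    sigma `^ (- alpha) *+ #|[predC B]|.
  rewrite -sumr_const; apply: eq_bigr => i iB.
  by rewrite /branch_rate (negbTE iB) sE.
have := cardC (mem B); rewrite card_ord => BC.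
have {BC} : (#|B|%:R : R) + #|[predC B]|%:R = p%:R
  by rewrite -natrD; congr (_%:R).
rewrite -[L `^ alpha *+ _]mulr_natl -[_ *+ #|[predC B]|]mulr_natl /total_rate.
have : (#|B|%:R : R) <= q%:R by rewrite ler_nat.
nra.
Qed.

Lemma transfer_fun_enum phi g u x : enumerates_fibre f (p := p) u x ->
  transfer_fun f phi g x = \sum_(i < p) expR (phi (u i)) * g (u i).
Proof. by move=> ux; rewrite /transfer_fun (fsum_fibre _ ux). Qed.

Lemma expR_sup phi x : expR (phi x) <= expR (sup (range phi)).
Proof.
rewrite ler_expR; apply: ub_le_sup; last by exists x.
exists `|phi| => _ [y _ <-].
exact: le_trans (ler_norm _) (le_norm_eval _ _).
Qed.

Lemma expR_inf phi x : expR (inf (range phi)) <= expR (phi x).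
Proof.
rewrite ler_expR; apply: ge_inf; last by exists x.
exists (- `|phi|) => _ [y _ <-].
by rewrite lerNl (le_trans _ (le_norm_eval phi y))// -normrN ler_norm.
Qed.

Lemma transfer_fun_sup phi g x :
  `|transfer_fun f phi g x| <= p%:R * expR (sup (range phi)) * sup_norm g.
Proof.
have [u ux] := fibre_enumeration f_degree x.
rewrite (transfer_fun_enum _ _ ux) (le_trans (ler_norm_sum _ _ _))//.
apply: (@le_trans _ _ (\sum_(i < p) expR (sup (range phi)) * sup_norm g)).
  apply: ler_sum => i _; rewrite normrM gtr0_norm ?expR_gt0//.
  by rewrite ler_pM ?expR_ge0 ?expR_sup ?sup_norm_ub.
by rewrite sumr_const card_ord -[leLHS]mulr_natl mulrA.
Qed.

Definition sup_rate phi : R :=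
  hoelder_const alpha (hexp phi) * total_rate +
    2 * (p%:R * expR (sup (range phi))) / delta `^ alpha.

Lemma total_rate_ge0 : 0 <= total_rate.
Proof.
rewrite /total_rate addr_ge0// mulr_ge0 ?powR_ge0//.
by rewrite subr_ge0 ler_nat.
Qed.

(** Nearby points: compare the two sums branch by branch. Distant points: the
    increment is bounded by the sup norm. *)
Lemma transfer_fun_increment phi g x x' :
  `|transfer_fun f phi g x - transfer_fun f phi g x'| <=
   (expR (sup (range phi)) * total_rate * hoelder_const alpha g +
     sup_rate phi * sup_norm g) * mdist x x' `^ alpha.
Proof.
set E := expR _; set c := hoelder_const alpha g; set s := sup_norm g.
have E0 : 0 < E by exact: expR_gt0.
have c0 : 0 <= c by exact: hoelder_const_ge0.
have s0 : 0 <= s by exact: sup_norm_ge0.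
have d0 : 0 <= mdist x x' `^ alpha by exact: powR_ge0.
have k0 := total_rate_ge0.
pose h := hoelder_const alpha (hexp phi).
have h0 : 0 <= h by exact: hoelder_const_ge0.
have da0 : 0 < delta `^ alpha by exact: powR_gt0.
have [xx'|xx'] := ltP (mdist x x') delta; last first.
  apply: (@le_trans _ _ (2 * (p%:R * E * s))).
    rewrite mulrDl mul1r (le_trans (ler_normB _ _))//.
    by rewrite lerD ?transfer_fun_sup.
  have dd : delta `^ alpha <= mdist x x' `^ alpha.
    by rewrite ge0_ler_powR ?nnegrE ?mdist_ge0 ?(ltW delta_gt0) ?(ltW alpha_gt0).
  apply: (@le_trans _ _ (2 * (p%:R * E) / delta `^ alpha * s * mdist x x' `^ alpha)).
    rewrite [leRHS](_ : _ = 2 * (p%:R * E * s) * (mdist x x' `^ alpha / delta `^ alpha)); last first.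
      by field; rewrite gt_eqF.
    rewrite ler_peMr// ?ler_pdivlMr ?mul1r//.
    by rewrite !mulr_ge0// ltW.
  rewrite ler_wpM2r// /sup_rate -/h -/E [(_ + _) * s]mulrDl addrA lerDr.
  by rewrite addr_ge0// !mulr_ge0// ltW.
have [u [v [B [ux vx Bq uv]]]] := matched xx'.
rewrite (transfer_fun_enum _ _ ux) (transfer_fun_enum _ _ vx) -sumrB.
apply: (le_trans (ler_norm_sum _ _ _)).
apply: (@le_trans _ _ (\sum_(i < p) (E * c + h * s) *
    (branch_rate sigma L B i `^ alpha * mdist x x' `^ alpha))).
  apply: ler_sum => i _.
  have uvd : mdist (u i) (v i) `^ alpha <=
      branch_rate sigma L B i `^ alpha * mdist x x' `^ alpha.
    have r0 := ltW (branch_rate_gt0 B i).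
    rewrite -powRM ?mdist_ge0//.
    by rewrite ge0_ler_powR ?nnegrE ?mulr_ge0 ?mdist_ge0 ?(ltW alpha_gt0).
  have -> : expR (phi (u i)) * g (u i) - expR (phi (v i)) * g (v i) =
    expR (phi (u i)) * (g (u i) - g (v i)) +
    (hexp phi (u i) - hexp phi (v i)) * g (v i) by rewrite !hexpE; ring.
  rewrite (le_trans (ler_normD _ _))// !normrM mulrDl lerD//.
    rewrite gtr0_norm ?expR_gt0// -mulrA ler_pM ?expR_ge0 ?expR_sup//.
    by rewrite (le_trans (hoelder_increment _ _ _))// ler_wpM2l.
  rewrite mulrAC ler_pM ?sup_norm_ub//.
  by rewrite (le_trans (hoelder_increment _ _ _))// ler_wpM2l.
rewrite -mulr_sumr -mulr_suml mulrA ler_wpM2r//.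
apply: (@le_trans _ _ ((E * c + h * s) * total_rate)).
  by rewrite ler_wpM2l ?sum_branch_rate// addr_ge0// mulr_ge0// ltW.
rewrite /sup_rate -/h -/E.
have : 0 <= 2 * (p%:R * E) / delta `^ alpha * s.
  by rewrite !mulr_ge0// ?invr_ge0 ltW.
nra.
Qed.

Lemma sup_rate_ge0 phi : 0 <= sup_rate phi.
Proof.
by rewrite addr_ge0 ?mulr_ge0 ?expR_ge0 ?invr_ge0 ?powR_ge0
  ?hoelder_const_ge0 ?total_rate_ge0.
Qed.

Lemma transfer_fun_hoelder phi g : Defs.hoelder alpha (transfer_fun f phi g).
Proof.
set a := p%:R * expR (sup (range phi)) * sup_norm g.
set b := expR (sup (range phi)) * total_rate * hoelder_const alpha g +
     sup_rate phi * sup_norm g.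
have a0 : 0 <= a by rewrite !mulr_ge0 ?expR_ge0 ?sup_norm_ge0.
have b0 : 0 <= b.
  by rewrite addr_ge0 ?mulr_ge0 ?expR_ge0 ?sup_norm_ge0 ?total_rate_ge0
    ?hoelder_const_ge0 ?sup_rate_ge0.
exists (a + b); split=> [x|x y].
  by rewrite (le_trans (transfer_fun_sup _ _ _))// lerDl.
by rewrite (le_trans (transfer_fun_increment _ _ _ _))// ler_wpM2r ?powR_ge0// lerDr.
Qed.

Lemma transferE phi g x : transfer f phi g x = transfer_fun f phi g x.
Proof.
rewrite /transfer -[LHS]/(\val (insubd (0 : V) (transfer_fun f phi g)) x).
by rewrite insubdK//; apply/asboolP; exact: transfer_fun_hoelder.
Qed.

Lemma transfer_linear phi : linear (transfer f phi).
Proof.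
move=> a g k; apply: hoelder_ext => x.
have [u ux] := fibre_enumeration f_degree x.
rewrite evalD evalZ !transferE !(transfer_fun_enum _ _ ux) mulr_sumr -big_split.
apply: eq_bigr => i _; rewrite -[(a *: g + k) _]/(a * g (u i) + k (u i)) /=.
by ring.
Qed.

Lemma transfer_sup_norm phi g :
  sup_norm (transfer f phi g) <= p%:R * expR (sup (range phi)) * sup_norm g.
Proof.
by apply: sup_norm_le => x; rewrite transferE; exact: transfer_fun_sup.
Qed.

Lemma transfer_hoelder_const phi g : hoelder_const alpha (transfer f phi g) <=
  expR (sup (range phi)) * total_rate * hoelder_const alpha g +
    sup_rate phi * sup_norm g.
Proof.
apply: hoelder_const_le_increment => [|x y].
  by rewrite addr_ge0 ?mulr_ge0 ?expR_ge0 ?sup_norm_ge0 ?total_rate_ge0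
    ?hoelder_const_ge0 ?sup_rate_ge0.
by rewrite !transferE; exact: transfer_fun_increment.
Qed.

Definition transfer_cst phi : R := p%:R * expR (sup (range phi)) +
  sup_rate phi + expR (sup (range phi)) * total_rate.

Lemma transfer_cst_ge0 phi : 0 <= transfer_cst phi.
Proof.
have r0 := sup_rate_ge0 phi; have E0 := expR_ge0 (sup (range phi)).
have Ek := mulr_ge0 E0 total_rate_ge0.
by apply: addr_ge0 => //; apply: addr_ge0 => //; exact: mulr_ge0.
Qed.

Lemma norm_transfer phi g : `|transfer f phi g| <= transfer_cst phi * `|g|.
Proof.
rewrite !hoelder_normE.
apply: (le_trans (lerD (transfer_sup_norm phi g) (transfer_hoelder_const phi g))).
have s0 := sup_norm_ge0 g; have c0 := hoelder_const_ge0 g.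
have r0 := sup_rate_ge0 phi; have k0 := total_rate_ge0.
have E0 := expR_ge0 (sup (range phi)).
have pE : 0 <= p%:R * expR (sup (range phi)) by rewrite mulr_ge0.
have Ek : 0 <= expR (sup (range phi)) * total_rate by rewrite mulr_ge0.
rewrite /transfer_cst; move: pE Ek r0 s0 c0.
move: (p%:R * _) (expR _ * _) (sup_rate _) (sup_norm _) (hoelder_const _ _).
by move=> *; nra.
Qed.

(** Perturbing the potential amounts to composing the operator with the
    multiplication by an exponential, which is analytic in the perturbation. *)
Lemma transferD phi H g :
  transfer f (phi + H) g = transfer f phi (hmul (hexp H) g).
Proof.
apply: hoelder_ext => x; have [u ux] := fibre_enumeration f_degree x.
rewrite !transferE !(transfer_fun_enum _ _ ux); apply: eq_bigr => i _.
by rewrite hmulE hexpE evalD expRD mulrA.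
Qed.

Lemma transfer_one_ge phi x :
  p%:R * expR (inf (range phi)) <= transfer f phi hone x.
Proof.
have [u ux] := fibre_enumeration f_degree x.
rewrite transferE (transfer_fun_enum _ _ ux).
apply: (@le_trans _ _ (\sum_(i < p) expR (inf (range phi)))).
  by rewrite sumr_const card_ord mulr_natl.
by apply: ler_sum => i _; rewrite mulr1 expR_inf.
Qed.

End Transfer.

(** * Integration of Hoelder functions *)

Section Integration.
Context {R : realType} {M : pointedMetricType R} {alpha : R}.
Hypothesis alpha_gt0 : 0 < alpha.
Local Notation V := (hoelder_space M alpha).
Variable nu : probability (borel M) R.
Implicit Types g k : V.

Lemma hoelder_continuous g : continuous (g : M -> R).
Proof.
move=> x; apply/cvgrPdist_le => e e0.
have c0 : 0 < hoelder_const alpha g + 1.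
  by rewrite ltr_wpDl ?hoelder_const_ge0.
have := near_dist_powR alpha_gt0 x (divr_gt0 e0 c0); apply: filterS => y xy.
rewrite (le_trans (hoelder_increment _ _ _))//.
rewrite ler_pdivlMr// in xy; apply: le_trans xy.
by rewrite mulrC ler_wpM2l ?powR_ge0// lerDl.
Qed.

Lemma continuous_borel_measurable (u : M -> R) : continuous u ->
  measurable_fun [set: borel M] (u : borel M -> R).
Proof.
move=> /continuousP cu; apply: (measurability _ (RGenOpens.measurableE R)).
move=> _ [_ [a [b ->] <-]]; rewrite setTI.
by apply: sub_sigma_algebra; apply: cu; exact: interval_open.
Qed.

Lemma hoelder_integrable g :
  nu.-integrable [set: borel M] (EFin \o (g : borel M -> R)).
Proof.
apply: measurable_bounded_integrable => //.
- by rewrite (le_lt_trans (probability_le1 nu _))// ltry.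
- by apply: continuous_borel_measurable; exact: hoelder_continuous.
- exists (sup_norm g); split; first exact: num_real.
  by move=> r gr x _; exact: (le_trans (sup_norm_ub g x) (ltW gr)).
Qed.

Definition integral_functional g : R := \int[nu]_x g x.

Lemma integral_linear : linear (integral_functional : V -> R^o).
Proof.
move=> a g k; rewrite /integral_functional.
rewrite (_ : (fun x => (a *: g + k) x) = (fun x => (a *: g) x + k x))//.
rewrite RintegralD//; [|exact: hoelder_integrable|exact: hoelder_integrable].
congr (_ + _); rewrite -[RHS]/(a * \int[nu]_x g x) -RintegralZl//.
exact: hoelder_integrable.
Qed.

Lemma integral_hone : integral_functional hone = 1.
Proof.
rewrite /integral_functional Rintegral_cst//.
rewrite mul1r -[RHS]/(fine 1%E); congr fine; exact: probability_setT.
Qed.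

Lemma integral_hone_scale (c : R) : integral_functional (c *: hone) = c.
Proof.
by rewrite (linZ integral_linear) integral_hone -[LHS]/(c * 1) mulr1.
Qed.

Lemma integral_le g k : (forall x, g x <= k x) ->
  integral_functional g <= integral_functional k.
Proof.
move=> gk; apply: le_Rintegral => //; first exact: hoelder_integrable.
exact: hoelder_integrable.
Qed.

Lemma norm_integral_le_sup g : `|integral_functional g| <= sup_norm g.
Proof.
rewrite ler_norml; apply/andP; split.
  rewrite -[leLHS]integral_hone_scale; apply: integral_le => x.
  rewrite evalZ mulr1 lerNl (le_trans _ (sup_norm_ub g x))//.
  by rewrite -normrN ler_norm.
rewrite -[leRHS]integral_hone_scale; apply: integral_le => x.
by rewrite evalZ mulr1 (le_trans _ (sup_norm_ub g x))// ler_norm.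
Qed.

End Integration.

(** * Perturbation of a simple eigenvalue *)

Ltac hoelder_ring :=
  let x := fresh "x" in
  apply: hoelder_ext => x; rewrite ?(evalB, evalD, evalZ, hmulE, honeE); ring.

Section Perturbation.
Context {R : realType} {M : pointedMetricType R} {alpha : R}.
Local Notation V := (hoelder_space M alpha).
Variables (T Res : {linear V -> V}) (nu : {linear V -> R^o}) (h0 : V).
Variables (l0 C b : R).
Hypothesis l0_gt0 : 0 < l0.
Hypothesis C_ge0 : 0 <= C.
Hypothesis b_ge0 : 0 <= b.
Hypothesis T_bound : forall x, `|T x| <= C * `|x|.
Hypothesis nu_bound : forall x, `|nu x| <= `|x|.
Hypothesis T_h0 : T h0 = l0 *: h0.
Hypothesis nu_T : forall x, nu (T x) = l0 * nu x.
Hypothesis nu_h0 : nu h0 = 1.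

(** [T] on the kernel of [nu], and [0] on [h0]: the eigenvalue [l0] is
    removed. *)
Definition deflated (x : V) : V := T x - (l0 * nu x) *: h0.

Hypothesis Res_bound : forall x, `|Res x| <= b * `|x|.
Hypothesis ResK : forall x, l0 *: Res x - deflated (Res x) = x.
Hypothesis KRes : forall x, Res (l0 *: x - deflated x) = x.

Lemma nu_deflated x : nu (deflated x) = 0.
Proof.
by rewrite /deflated linearB linearZ /= nu_T nu_h0 -[_ *: 1]/(_ * 1) mulr1 subrr.
Qed.

Lemma nu_Res x : nu x = 0 -> nu (Res x) = 0.
Proof.
move=> x0; have := congr1 nu (ResK x); rewrite linearB linearZ /= nu_deflated.
rewrite subr0 x0 -[_ *: nu _]/(l0 * nu _) => /eqP.
by rewrite mulf_eq0 gt_eqF//= => /eqP.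
Qed.

Lemma Res_ker x : nu x = 0 -> l0 *: Res x - T (Res x) = x.
Proof.
by move=> x0; rewrite -[RHS]ResK /deflated (nu_Res x0) mulr0 scale0r subr0.
Qed.

Lemma ker_bound x : nu x = 0 -> `|x| <= b * `|l0 *: x - T x|.
Proof.
move=> x0; rewrite -[X in `|X| <= _]KRes (le_trans (Res_bound _))//.
by rewrite /deflated x0 mulr0 scale0r subr0.
Qed.

Definition ker_proj (x : V) : V := x - nu x *: h0.

Lemma nu_ker_proj x : nu (ker_proj x) = 0.
Proof.
by rewrite /ker_proj linearB linearZ /= nu_h0 -[_ *: 1]/(_ * 1) mulr1 subrr.
Qed.

Lemma norm_ker_proj x : `|ker_proj x| <= (1 + `|h0|) * `|x|.
Proof.
rewrite /ker_proj (le_trans (ler_normB _ _))// mulrDl mul1r lerD2l normrZ mulrC.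
by rewrite ler_wpM2l.
Qed.

Lemma succ_norm_ge0 : 0 <= 1 + `|h0|.
Proof. exact: (addr_ge0 ler01 (normr_ge0 h0)). Qed.

Lemma nu_linear (a : R) (x y : V) : nu (a *: x + y) = a * nu x + nu y.
Proof. exact: linearP. Qed.

Lemma ker_proj_linear : linear ker_proj.
Proof. by move=> a x y; rewrite /ker_proj nu_linear; hoelder_ring. Qed.

(** With [E = e^H - 1] and an eigenvector [h0 + w], [nu w = 0], of eigenvalue
    [l0 + z], the eigenvalue equation splits into
    [z = l0 * nu (E (h0 + w))] and
    [w = Res (ker_proj (T (E (h0 + w)))) - z *: Res w].
    The single unknown [u = w + z *: h0] satisfies
    [u = corrector (E (h0 + w)) - nu u *: Res w]. *)
Definition corrector (x : V) : V := Res (ker_proj (T x)) + (l0 * nu x) *: h0.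

Lemma corrector_linear : linear corrector.
Proof.
move=> a x y; rewrite /corrector nu_linear linearP ker_proj_linear linearP.
by hoelder_ring.
Qed.

Lemma nu_corrector x : nu (corrector x) = l0 * nu x.
Proof.
rewrite /corrector linearD linearZ /= nu_h0 nu_Res ?nu_ker_proj// add0r.
by rewrite -[_ *: 1]/(_ * 1) mulr1.
Qed.

Lemma ker_proj_corrector x : ker_proj (corrector x) = Res (ker_proj (T x)).
Proof. by rewrite /ker_proj nu_corrector /corrector -/(ker_proj _) addrK. Qed.

Definition corrector_cst : R := b * (1 + `|h0|) * C + l0 * `|h0|.

Lemma corrector_cst_ge0 : 0 <= corrector_cst.
Proof.
have h := normr_ge0 h0; have l00 := ltW l0_gt0.
by apply: addr_ge0; apply: mulr_ge0 => //; apply: mulr_ge0 => //; exact: addr_ge0.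
Qed.

Lemma norm_corrector x : `|corrector x| <= corrector_cst * `|x|.
Proof.
rewrite /corrector /corrector_cst (le_trans (ler_normD _ _))// mulrDl lerD//.
  rewrite (le_trans (Res_bound _))// -!mulrA ler_wpM2l//.
  rewrite (le_trans (norm_ker_proj _))// ler_wpM2l ?succ_norm_ge0//.
rewrite normrZ normrM gtr0_norm// -!mulrA ler_wpM2l ?(ltW l0_gt0)//.
by rewrite mulrC ler_wpM2l.
Qed.

(** The pair [(e^H - 1, u)] is taken as the unknown, so that the equation for
    [u] becomes quadratic with a source that is a power series in [H]. *)
Definition source_embedding (e : V) : V * V := (e, corrector (hmul e h0)).

Lemma source_embedding_linear : linear source_embedding.
Proof.
by move=> a x y; congr pair; rewrite hmul_linearl corrector_linear.
Qed.

Definition source (n : nat) (v : nat -> V) : V * V :=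
  if n is 0%N then 0 else source_embedding (n`!%:R^-1 *: hprod n v).

Definition coupling (x y : V * V) : V * V :=
  (0, corrector (hmul x.1 (ker_proj y.2)) - nu x.2 *: Res (ker_proj y.2)).

Definition source_cst : R := 1 + corrector_cst * `|h0|.

Lemma source_cst_ge0 : 0 <= source_cst.
Proof. by rewrite addr_ge0// mulr_ge0// corrector_cst_ge0. Qed.

Lemma norm_source_embedding e : `|source_embedding e| <= source_cst * `|e|.
Proof.
rewrite prod_normE /= ge_max; apply/andP; split.
  by rewrite ler_peMl// lerDl mulr_ge0// corrector_cst_ge0.
rewrite (le_trans (norm_corrector _))//.
rewrite (le_trans (ler_wpM2l corrector_cst_ge0 (norm_hmul _ _)))//.
rewrite [leRHS](_ : _ = `|e| + corrector_cst * (`|e| * `|h0|)) ?lerDr//.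
by rewrite /source_cst; ring.
Qed.

Lemma source_multilinear n : multilinear_upto n (source n).
Proof.
case: n => [|n]; first by split.
have [h1 h2] := @hprod_multilinear R M alpha n.+1.
split=> [v w vw|v j a x y jn]; rewrite /source; first by rewrite (h1 v w).
rewrite h2// scalerDr scalerA mulrC -scalerA.
exact: source_embedding_linear.
Qed.

Lemma norm_source n v : `|source n v| <= source_cst * \prod_(i < n) `|v i|.
Proof.
have p0 : 0 <= source_cst * \prod_(i < n) `|v i|.
  by rewrite mulr_ge0 ?source_cst_ge0 ?prodr_ge0.
case: n p0 => [|n] p0; first by rewrite normr0.
rewrite (le_trans (norm_source_embedding _))// ler_wpM2l ?source_cst_ge0//.
rewrite normrZ ger0_norm ?invr_ge0// (le_trans _ (norm_hprod _ _))//.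
by rewrite ler_piMl// invf_le1 ?ltr0n ?fact_gt0// ler1n fact_gt0.
Qed.

Lemma coupling_linearl y : linear (coupling^~ y).
Proof.
move=> a x x'; rewrite /coupling /= hmul_linearl corrector_linear nu_linear.
congr pair; first by rewrite /= scaler0 addr0.
by rewrite /=; hoelder_ring.
Qed.

Lemma coupling_linearr x : linear (coupling x).
Proof.
move=> a y y'; rewrite /coupling /= ker_proj_linear hmul_linearr.
rewrite corrector_linear linearP; congr pair; first by rewrite /= scaler0 addr0.
by rewrite /=; hoelder_ring.
Qed.

Definition coupling_cst : R := (corrector_cst + b) * (1 + `|h0|).

Lemma coupling_cst_ge0 : 0 <= coupling_cst.
Proof. by rewrite mulr_ge0 ?succ_norm_ge0// addr_ge0 ?corrector_cst_ge0. Qed.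

Lemma norm_coupling x y : `|coupling x y| <= coupling_cst * `|x| * `|y|.
Proof.
have x1 : `|x.1| <= `|x| by rewrite prod_normE le_max lexx.
have x2 : `|x.2| <= `|x| by rewrite prod_normE le_max lexx orbT.
have y2 : `|y.2| <= `|y| by rewrite prod_normE le_max lexx orbT.
have k0 := corrector_cst_ge0.
rewrite prod_normE /= normr0 ge_max; apply/andP; split.
  by apply: mulr_ge0 => //; apply: mulr_ge0 => //; exact: coupling_cst_ge0.
have py : `|ker_proj y.2| <= (1 + `|h0|) * `|y|.
  by rewrite (le_trans (norm_ker_proj _))// ler_wpM2l// succ_norm_ge0.
rewrite (le_trans (ler_normB _ _))//.
rewrite [leRHS](_ : _ = corrector_cst * (`|x| * ((1 + `|h0|) * `|y|)) +
   `|x| * (b * ((1 + `|h0|) * `|y|))); last by rewrite /coupling_cst; ring.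
rewrite lerD//.
  rewrite (le_trans (norm_corrector _))// ler_wpM2l//.
  by rewrite (le_trans (norm_hmul _ _))// ler_pM.
rewrite normrZ ler_pM//; first by rewrite (le_trans (nu_bound _)).
by rewrite (le_trans (Res_bound _))// ler_wpM2l.
Qed.

Lemma cvg_source_series H :
  (fun N => \sum_(0 <= n < N) source n (fun=> H)) @ \oo -->
    source_embedding (hexp H - hone).
Proof.
pose j : {linear V -> (V * V)%type} := HB.pack source_embedding
  (GRing.isLinear.Build _ _ _ _ source_embedding source_embedding_linear).
have jc : continuous j := linear_bound_continuous (A := j) norm_source_embedding.
rewrite -(cvg_shiftS _) /=.
have -> : (fun N => \sum_(0 <= n < N.+1) source n (fun=> H)) =
    (fun N => source_embedding (series (hexp_coeff H) N.+1 - hone)).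
  apply/funext => N; rewrite /series /= big_nat_recl// add0r.
  rewrite [in RHS]big_nat_recl// [hexp_coeff H 0](_ : _ = hone).
    by rewrite [hone + _]addrC addrK (lin_sum source_embedding_linear).
  by rewrite /hexp_coeff /= invr1 scale1r.
apply: (cvg_comp (fun N => series (hexp_coeff H) N.+1 - hone) j _ (jc _)).
apply: cvgB; last exact: cvg_cst.
by have := @cvg_hexp_series R M alpha H; rewrite -(cvg_shiftS (series _)); exact.
Qed.

Lemma nu_mul (a : R) x : nu (a *: x) = a * nu x.
Proof. exact: linearZ. Qed.

(** Applying [nu] and [ker_proj] to the equation for [u] gives back the two
    halves of the eigenvalue equation. *)
Lemma coupling_fixpoint_eigenvector (H : V) (x : V * V) :
  x = source_embedding (hexp H - hone) + coupling x x ->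
  T (hmul (hexp H) (h0 + ker_proj x.2)) =
    (l0 + nu x.2) *: (h0 + ker_proj x.2).
Proof.
case: x => e u /= [eE uE]; rewrite addr0 in eE.
set w := ker_proj u; set E := hexp H - hone in eE *.
have w0 : nu w = 0 by exact: nu_ker_proj.
have u1 : u = corrector (hmul E (h0 + w)) - nu u *: Res w.
  rewrite (linD (hmul_linearr E) h0 w) (linD corrector_linear (hmul E h0)).
  by rewrite {1}uE eE addrA.
have zE : nu u = l0 * nu (hmul E (h0 + w)).
  rewrite {1}u1 linearB linearZ /= nu_corrector nu_Res// -[_ *: 0]/(_ * 0).
  by rewrite mulr0 subr0.
have wE : w = Res (ker_proj (T (hmul E (h0 + w)))) - nu u *: Res w.
  rewrite {1}/w {1}u1 (linB ker_proj_linear) ker_proj_corrector.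
  rewrite (linZ ker_proj_linear) /ker_proj (nu_Res w0) scale0r subr0.
  by rewrite -/(ker_proj _).
have AE := Res_ker w0; have BE := Res_ker (nu_ker_proj (T (hmul E (h0 + w)))).
have lw : l0 *: w - T w = ker_proj (T (hmul E (h0 + w))) - nu u *: w.
  set X := Res (ker_proj _) in wE BE; set r := Res w in wE AE.
  transitivity (l0 *: (X - nu u *: r) - T (X - nu u *: r)).
    by congr (l0 *: _ - T _).
  rewrite -BE -[in RHS]AE [T (_ - _)]linearB [T (_ *: _)]linearZ /=.
  by hoelder_ring.
have hE : hmul (hexp H) (h0 + w) = (h0 + w) + hmul E (h0 + w).
  by rewrite /E; hoelder_ring.
rewrite hE linearD linearD /= T_h0.
have -> : T w = l0 *: w - (ker_proj (T (hmul E (h0 + w))) - nu u *: w).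
  by rewrite -lw opprB addrC subrK.
rewrite /ker_proj nu_T -zE; hoelder_ring.
Qed.

(** The constant term [l0] and the series of the quadratic equation, composed
    with [nu], expand the perturbed eigenvalue. *)
Theorem eigenvalue_branch :
  exists (P : nat -> (nat -> V) -> R^o) (B : nat -> R) (K rho : R),
  [/\ 0 < rho, forall n, multilinear_upto n (P n),
      forall n v, `|P n v| <= B n * \prod_(i < n) `|v i|,
      forall v, P 0%N v = l0 /\ P 1%N v = l0 * nu (hmul (v 0%N) h0) &
      forall H, rho * `|H| <= 1 / 4 -> exists (z : R) (w : V),
      [/\ nu w = 0, T (hmul (hexp H) (h0 + w)) = z *: (h0 + w),
          `|w| <= K * (rho * `|H|) &
          forall N, `|z - \sum_(0 <= n < N) P n (fun=> H)| <=
            K * (rho * `|H|) ^+ N]].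
Proof.
have source0 v : source 0%N v = 0 by [].
have [a [K0 [rho [K0_gt0 rho_gt0 am ab [a01 sol]]]]] :=
  quadratic_equation_solution source0 source_multilinear norm_source
    coupling_linearl coupling_linearr coupling_cst_ge0 norm_coupling.
pose P n (v : nat -> V) : R^o := if n is 0%N then l0 else nu (a n v).2.
pose B n := if n is 0%N then l0 else K0 * rho ^+ n.
pose K := K0 * (1 + `|h0|) + l0.
have hK : K0 <= K0 * (1 + `|h0|) by rewrite ler_peMr ?(ltW K0_gt0)// lerDl.
have nu2 (y : V * V) : `|nu y.2| <= `|y|.
  by rewrite (le_trans (nu_bound _))// prod_normE le_max lexx orbT.
exists P, B, K, rho; split => //.
- case=> [|n]; first by split=> // v j c x y; rewrite ltn0.
  have [a1 a2] := am n.+1; split=> [v w vw|v j c x y jn]; rewrite /P.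
    by rewrite (a1 v w).
  by rewrite a2// -[RHS]nu_linear.
- case=> [|n] v; first by rewrite big_ord0 mulr1 /P /B gtr0_norm.
  by rewrite /P /B (le_trans (nu2 _)).
- move=> v; split=> //; rewrite /P (a01 v).2 /source /= nu_corrector.
  rewrite invr1 scale1r; congr (_ * nu (hmul _ _)).
  by apply: hoelder_ext => x; rewrite hmulE mul1r.
move=> H Hr; have [x [xE xN]] := sol H _ Hr (cvg_source_series (H := H)).
have t0 : 0 <= rho * `|H| by rewrite mulr_ge0// ltW.
exists (l0 + nu x.2), (ker_proj x.2); split.
- exact: nu_ker_proj.
- exact: coupling_fixpoint_eigenvector.
- have := xN 1%N; rewrite big_nat1 (a01 _).1 subr0 expr1 => x1.
  have x2 : `|x.2| <= `|x| by rewrite prod_normE le_max lexx orbT.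
  rewrite (le_trans (norm_ker_proj _))//.
  rewrite (le_trans (ler_wpM2l succ_norm_ge0 (le_trans x2 x1)))//.
  by rewrite [leLHS]mulrA ler_wpM2r// /K mulrC lerDl ltW.
case=> [|N].
  have := xN 0%N; rewrite !big_geq// !subr0 expr0 !mulr1 => x0.
  rewrite (le_trans (ler_normD _ _))// gtr0_norm// addrC lerD2r.
  by rewrite (le_trans (nu2 _))// (le_trans x0).
have -> : l0 + nu x.2 - \sum_(0 <= n < N.+1) P n (fun=> H) =
    nu (x - \sum_(0 <= n < N.+1) a n (fun=> H)).2.
  rewrite [in RHS]big_nat_recl// (a01 _).1 add0r big_nat_recl//.
  rewrite [P 0%N _]/= opprD addrACA subrr add0r.
  have -> : (x - \sum_(0 <= i < N) a i.+1 (fun=> H)).2 =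
      x.2 - \sum_(0 <= i < N) (a i.+1 (fun=> H)).2.
    by congr (_ - _); elim/big_ind2: _ => // [[y1 y2] z1 [y1' y2'] z2 <- <-].
  by rewrite linearB; congr (_ - _); rewrite [RHS]linear_sum.
rewrite (le_trans (nu2 _))// (le_trans (xN _))// ler_wpM2r ?exprn_ge0//.
by rewrite (le_trans hK)// lerDl ltW.
Qed.

(** Close to [l0], the perturbed operator has no other eigenvalue: the
    difference of two normalised eigenvectors lies in the kernel of [nu],
    where [l0 - T] is bounded below. *)
Lemma eigenvalue_unique : exists2 eta : R, 0 < eta &
  forall H w g (mu z : R), nu w = 0 -> `|w| <= 1 ->
    `|hexp H - hone| <= eta -> `|z - l0| <= eta ->
    T (hmul (hexp H) (h0 + w)) = mu *: (h0 + w) ->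
    T (hmul (hexp H) g) = z *: g -> g != 0 -> z = mu.
Proof.
pose D := b * (1 + C + l0 * (`|h0| + 1)).
have l00 := ltW l0_gt0.
have hh : 0 <= `|h0| + 1 by rewrite addrC succ_norm_ge0.
have hD : 0 <= l0 * (`|h0| + 1) by exact: mulr_ge0.
have D0 : 0 <= D by rewrite mulr_ge0// addr_ge0// addr_ge0.
pose eta := (2 * (D + 1))^-1.
have eta0 : 0 < eta by rewrite invr_gt0; lra.
have Deta : D * eta < 1.
  by rewrite ltr_pdivrMr ?mul1r; lra.
exists eta => // H w g mu z w0 w1 Eeta zeta gw gz g0.
set E := hexp H - hone in Eeta.
have hE y : hmul (hexp H) y = y + hmul E y by rewrite /E; hoelder_ring.
have TE y : `|T (hmul E y)| <= C * eta * `|y|.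
  rewrite (le_trans (T_bound _))// -mulrA ler_wpM2l//.
  by rewrite (le_trans (norm_hmul _ _))// ler_wpM2r.
have small (y : V) : `|y| <= D * eta * `|y| -> y = 0.
  move=> yD; apply/eqP; rewrite -normr_le0.
  have := normr_ge0 y; nra.
have ng : nu g != 0.
  apply: contra_neq g0 => ng; apply: small.
  apply: (le_trans (ker_bound ng)).
  have -> : l0 *: g - T g = (l0 - z) *: g + T (hmul E g).
    have -> : T (hmul E g) = z *: g - T g.
      by rewrite -gz hE linearD addrC addKr.
    by hoelder_ring.
  rewrite /D -!mulrA ler_wpM2l// (le_trans (ler_normD _ _))//.
  have a1 : `|(l0 - z) *: g| <= eta * `|g| by rewrite normrZ distrC ler_wpM2r.
  have a2 := TE g; have eg : 0 <= eta * `|g| by rewrite mulr_ge0// ltW.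
  nra.
pose d := (nu g)^-1 *: g - (h0 + w).
have d0 : nu d = 0.
  rewrite /d linearB linearD nu_mul nu_h0 w0 mulVf//=.
  by rewrite addr0 subrr.
have dE : T (hmul (hexp H) d) = z *: d + (z - mu) *: (h0 + w).
  rewrite /d (linB (hmul_linearr _)) (linZ (hmul_linearr _)).
  rewrite [T (_ - _)]linearB [T (_ *: hmul _ _)]linearZ /= gz gw; hoelder_ring.
have zmu : z - mu = l0 * nu (hmul E d).
  have := congr1 nu dE; rewrite nu_T hE linearD d0 add0r /= => ->.
  by rewrite linearD !nu_mul d0 mulr0 add0r linearD nu_h0 w0 addr0 mulr1.
have nE : `|nu (hmul E d)| <= eta * `|d|.
  rewrite (le_trans (nu_bound _))// (le_trans (norm_hmul _ _))//.
  by rewrite ler_wpM2r.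
have : d = 0.
  apply: small; apply: (le_trans (ker_bound d0)).
  have -> : l0 *: d - T d = (l0 - z) *: d + T (hmul E d) - (z - mu) *: (h0 + w).
    have -> : T (hmul E d) = z *: d + (z - mu) *: (h0 + w) - T d.
      by rewrite -dE hE linearD addrC addKr.
    by hoelder_ring.
  rewrite /D -!mulrA ler_wpM2l//.
  rewrite (le_trans (ler_normB _ _))//.
  have a1 : `|(l0 - z) *: d| <= eta * `|d| by rewrite normrZ distrC ler_wpM2r.
  have a2 := TE d; have eg : 0 <= eta * `|d| by rewrite mulr_ge0// ltW.
  have a3 : `|(z - mu) *: (h0 + w)| <= l0 * (eta * `|d|) * (`|h0| + 1).
    rewrite normrZ ler_pM//.
      by rewrite zmu normrM gtr0_norm// ler_wpM2l.
    by rewrite (le_trans (ler_normD _ _))// lerD2l.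
  have a4 := le_trans (ler_normD ((l0 - z) *: d) (T (hmul E d))) (lerD a1 a2).
  have := lerD a4 a3; lra.
move=> d00; apply/eqP; rewrite -subr_eq0 zmu d00.
by rewrite (lin0 (hmul_linearr E)) linear0 mulr0.
Qed.

End Perturbation.

(** * The leading eigenvalue of the transfer operator *)

Section Radius.
Context {R : realType}.

Lemma small_scale (e c C : R) : 0 < e -> 0 < c -> 0 <= C ->
  exists s, [/\ 0 < s, 2 * s <= 1, 2 * s <= e & C * (2 * s) < c].
Proof.
move=> e0 c0 C0; have C1 : 0 < C + 1 by lra.
have cC : 0 < c / (C + 1) by exact: divr_gt0.
pose t := Num.min (Num.min 1 e) (c / (C + 1)).
exists (t / 2); rewrite (_ : 2 * (t / 2) = t); last by field.
have t0 : 0 < t by rewrite !lt_min ltr01 e0 cC.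
have : t <= c / (C + 1) by rewrite ge_min lexx orbT.
rewrite ler_pdivlMr// => tc; split.
- by rewrite divr_gt0.
- by rewrite !ge_min lexx.
- by rewrite !ge_min lexx orbT.
- lra.
Qed.

(** The power series is used on balls [rho * t <= 1 / 4] only: smallness
    conditions on [t] are met by increasing [rho]. *)
Lemma refined_rate (rho k r s : R) : 0 < rho -> 0 <= k -> 0 < r -> 0 < s ->
  exists2 rho', rho <= rho' & forall t, 0 <= t -> rho' * t <= 1 / 4 ->
    [/\ rho * t <= 1 / 4, t < r, t <= s, t <= 1 / 4 & k * (rho * t) <= s].
Proof.
move=> rho0 k0 r0 s0.
have r1 : 0 < r^-1 by rewrite invr_gt0.
have s1 : 0 < s^-1 by rewrite invr_gt0.
have rk : 0 <= rho * k / s by rewrite !mulr_ge0// ltW.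
exists (rho + rho * k / s + r^-1 + s^-1 + 1); first lra.
move=> t t0 ht; rewrite !mulrDl mul1r in ht.
have t1 : 0 <= r^-1 * t by rewrite mulr_ge0// ltW.
have t2 : 0 <= s^-1 * t by rewrite mulr_ge0// ltW.
have t3 : 0 <= rho * t by rewrite mulr_ge0// ltW.
have t4 : 0 <= rho * k / s * t by rewrite mulr_ge0.
have u1 : r^-1 * t < 1 by lra.
have u2 : s^-1 * t <= 1 by lra.
have u3 : rho * k / s * t <= 1 by lra.
split; [lra| | |lra|].
- by rewrite mulrC ltr_pdivrMr ?mul1r in u1.
- by rewrite mulrC ler_pdivrMr ?mul1r in u2.
- by rewrite mulrAC ler_pdivrMr ?mul1r// in u3; rewrite mulrA [k * _]mulrC.
Qed.

End Radius.

Section LeadingEigenvalue.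
Context {R : realType} {M : pointedMetricType R}.
Variables (f : M -> M) (p q : nat) (sigma L alpha delta : R).
Hypothesis M_compact : compact [set: M].
Hypothesis f_degree : has_degree f p.
Hypothesis sigma_gt1 : 1 < sigma.
Hypothesis L_ge1 : 1 <= L.
Hypothesis q_lt_p : (q < p)%N.
Hypothesis alpha_gt0 : 0 < alpha.
Hypothesis delta_gt0 : 0 < delta.
Hypothesis matched : forall x x',
  mdist x x' < delta -> matched_fibres f p sigma L q x x'.
Local Notation V := (hoelder_space M alpha).
Implicit Types phi g : V.

Let q_le_p : (q <= p)%N := ltnW q_lt_p.

Definition transfer_lin phi : {linear V -> V} :=
  HB.pack (transfer f phi) (GRing.isLinear.Build _ _ _ _ (transfer f phi)
    (transfer_linear f_degree sigma_gt1 L_ge1 q_le_p alpha_gt0 delta_gt0 matched phi)).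

Definition integral_lin (nu : probability (borel M) R) : {linear V -> R^o} :=
  HB.pack (integral_functional nu : V -> R^o)
    (GRing.isLinear.Build _ _ _ _ (integral_functional nu : V -> R^o)
      (integral_linear alpha_gt0 nu)).

Let transfE phi g x : transfer f phi g x = transfer_fun f phi g x.
Proof.
exact: (transferE f_degree sigma_gt1 L_ge1 q_le_p alpha_gt0 delta_gt0 matched).
Qed.

Let C phi : R := transfer_cst p q sigma L delta phi.

Let C_ge0 phi : 0 <= C phi. Proof. exact: transfer_cst_ge0. Qed.

Let norm_T phi g : `|transfer f phi g| <= C phi * `|g|.
Proof.
exact: (norm_transfer f_degree sigma_gt1 L_ge1 q_le_p alpha_gt0 delta_gt0 matched).
Qed.

Let TD phi H g : transfer f (phi + H) g = transfer f phi (hmul (hexp H) g).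
Proof.
exact: (transferD f_degree sigma_gt1 L_ge1 q_le_p alpha_gt0 delta_gt0 matched).
Qed.

Lemma eigenvalue_le_lambda phi (z : R) g :
  g != 0 -> transfer f phi g = z *: g -> `|z| <= lambda f phi.
Proof.
exact: (@eigenvalue_le_spectral_radius R _ (transfer_lin phi) (C phi) (norm_T phi)).
Qed.

Lemma integral_transfer phi nu g : conformal f phi nu ->
  integral_functional nu (transfer f phi g) =
    lambda f phi * integral_functional nu g.
Proof.
move=> nuc; rewrite /integral_functional.
have := nuc g (@hoelder_continuous _ _ _ alpha_gt0 g).
by under eq_Rintegral do rewrite -transfE.
Qed.

Lemma lambda_ge phi nu : conformal f phi nu ->
  p%:R * expR (inf (range phi)) <= lambda f phi.
Proof.
move=> nuc; have := integral_transfer hone nuc.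
rewrite integral_hone mulr1 => <-.
rewrite -[leLHS](integral_hone_scale alpha_gt0 nu); apply: integral_le => // x.
rewrite evalZ mulr1.
exact: (transfer_one_ge f_degree sigma_gt1 L_ge1 q_le_p alpha_gt0 delta_gt0 matched).
Qed.

Variables (phi0 : V) (nu0 : probability (borel M) R) (h0 : V).
Hypothesis nu0_conformal : conformal f phi0 nu0.
Hypothesis h0_unique : unique (normalized_eigenfunction f phi0 nu0) h0.
Hypothesis rate_lt :
  expR (sup (range phi0)) * total_rate p q sigma L alpha < lambda f phi0.

Let l0 := lambda f phi0.
Let T := transfer_lin phi0.
Let nu := integral_lin nu0.
Let a := expR (sup (range phi0)) * total_rate p q sigma L alpha.
Let K := p%:R * expR (sup (range phi0)) + sup_rate p q sigma L delta phi0.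

Let p_gt0 : 0 < p%:R :> R.
Proof. by rewrite ltr0n (leq_ltn_trans _ q_lt_p). Qed.

Lemma lambda_gt0 : 0 < l0.
Proof.
by apply: lt_le_trans (lambda_ge nu0_conformal); rewrite mulr_gt0// expR_gt0.
Qed.

Let T_h0 : T h0 = l0 *: h0.
Proof.
case: h0_unique => [[hE _] _]; apply: hoelder_ext => x.
by rewrite /T /= transfE hE.
Qed.

Let nu_h0 : nu h0 = 1. Proof. by case: h0_unique => [[]]. Qed.

Let nu_T x : nu (T x) = l0 * nu x.
Proof. exact: integral_transfer. Qed.

Let nu_sup x : `|nu x| <= sup_norm x.
Proof. exact: norm_integral_le_sup. Qed.

Let nu_norm x : `|nu x| <= `|x|.
Proof. exact: le_trans (nu_sup x) (sup_norm_le_norm x). Qed.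

Let norm_T0 g : `|T g| <= C phi0 * `|g|. Proof. exact: norm_T. Qed.

Let K_ge0 : 0 <= K.
Proof.
have r0 : 0 <= sup_rate p q sigma L delta phi0 by exact: sup_rate_ge0.
by rewrite addr_ge0// mulr_ge0// ?expR_ge0// ltW.
Qed.

Let T_sup g : sup_norm (T g) <= K * sup_norm g.
Proof.
have h := transfer_sup_norm f_degree sigma_gt1 L_ge1 q_le_p alpha_gt0 delta_gt0
  matched phi0 g.
apply: (le_trans h); rewrite ler_wpM2r ?sup_norm_ge0// lerDl.
exact: sup_rate_ge0.
Qed.

Let T_hoelder g : hoelder_const alpha (T g) <=
  a * hoelder_const alpha g + K * sup_norm g.
Proof.
have h := transfer_hoelder_const f_degree sigma_gt1 L_ge1 q_le_p alpha_gt0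
  delta_gt0 matched phi0 g.
apply: (le_trans h); rewrite lerD2l ler_wpM2r ?sup_norm_ge0// lerDr.
by rewrite mulr_ge0 ?expR_ge0 ?(ltW p_gt0).
Qed.

(** Above the spectral radius there is no eigenvalue. *)
Lemma resolvent_bounded_below (e Z : R) : 0 < e -> exists2 c : R, 0 < c &
  forall z g, l0 + e <= z <= Z -> c * `|g| <= `|z *: g - T g|.
Proof.
move=> e0; have l00 := lambda_gt0.
apply: (lasota_yorke_bounded_below M_compact alpha_gt0 K_ge0 _ _ T_sup T_hoelder).
- by apply: (lt_trans rate_lt); rewrite -/l0; lra.
- by lra.
move=> z g /andP[z1 _] Tg; apply/eqP; apply: contrapT => /negP g0.
have := eigenvalue_le_lambda g0 Tg; have := ler_norm z; rewrite -/l0; lra.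
Qed.

Let Td := deflated T nu h0 l0.

Let Td_linear : linear Td.
Proof.
move=> c x y; rewrite /Td /deflated nu_linear linearP; hoelder_ring.
Qed.

Let TdL : {linear V -> V} :=
  HB.pack Td (GRing.isLinear.Build _ _ _ _ Td Td_linear).

Let norm_l0h0 g : `|(l0 * nu g) *: h0| <= l0 * `|h0| * sup_norm g.
Proof.
rewrite normrZ normrM gtr0_norm ?lambda_gt0// mulrAC.
by rewrite ler_wpM2l// mulr_ge0// ltW// lambda_gt0.
Qed.

Let Td_sup g : sup_norm (TdL g) <= (K + l0 * `|h0|) * sup_norm g.
Proof.
rewrite mulrDl; have -> : TdL g = T g + (- 1) *: ((l0 * nu g) *: h0).
  by rewrite scaleN1r.
rewrite (le_trans (sup_normD _ _))// lerD// (le_trans (sup_normZ _ _))//.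
rewrite normrN1 mul1r (le_trans (sup_norm_le_norm _))//.
Qed.

Let Td_hoelder g : hoelder_const alpha (TdL g) <=
  a * hoelder_const alpha g + (K + l0 * `|h0|) * sup_norm g.
Proof.
have l00 := ltW lambda_gt0.
have hh : 0 <= l0 * `|h0| * sup_norm g by rewrite !mulr_ge0 ?sup_norm_ge0.
have Tg := T_hoelder g; have Tg0 := hoelder_const_ge0 (T g).
rewrite mulrDl addrA; apply: hoelder_const_le_increment => [|x y].
  by rewrite addr_ge0// (le_trans Tg0).
have -> : TdL g x - TdL g y = (T g x - T g y) -
    (((l0 * nu g) *: h0) x - ((l0 * nu g) *: h0) y).
  by rewrite !(evalB, evalZ); ring.
rewrite (le_trans (ler_normB _ _))// mulrDl lerD//.
  by rewrite (le_trans (hoelder_increment _ _ _))// ler_wpM2r ?powR_ge0.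
rewrite (le_trans (hoelder_increment _ _ _))// ler_wpM2r ?powR_ge0//.
exact: le_trans (hoelder_const_le_norm _) (norm_l0h0 g).
Qed.

(** The deflated operator no longer has the eigenvalue [l0]: an eigenvector
    of [T] for [l0] in the kernel of [nu] could be added to [h0], against the
    uniqueness of the normalised eigenfunction. *)
Lemma deflated_injective z g : l0 <= z -> TdL g = z *: g -> g = 0.
Proof.
have l00 := lambda_gt0; move=> lz Tg.
have ng : nu g = 0.
  have := congr1 nu Tg; rewrite nu_deflated// nu_mul => /esym/eqP.
  by rewrite mulf_eq0 gt_eqF/=; [move/eqP|lra].
have Tg' : T g = z *: g by rewrite -Tg /TdL /= /Td /deflated ng mulr0 scale0r subr0.
apply/eqP; apply: contrapT => /negP g0.
have zl : z = l0.
  apply/eqP; rewrite eq_le lz andbT.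
  by have := eigenvalue_le_lambda g0 Tg'; apply: le_trans; exact: ler_norm.
case: h0_unique => hP /(_ (h0 + g)) hU.
suff /eqP : h0 = h0 + g by rewrite -subr_eq0 opprD addrA subrr sub0r oppr_eq0 (negbTE g0).
apply: hU; split=> [x|].
  rewrite -transfE -[transfer f phi0]/(T : V -> V) linearD T_h0 Tg' zl.
  by rewrite -/l0 -evalZ scalerDr.
by have := linearD nu h0 g; rewrite nu_h0 ng addr0.
Qed.

Lemma deflated_resolvent : exists (Res : {linear V -> V}) (b : R),
  [/\ 0 <= b, forall x, `|Res x| <= b * `|x|,
      forall x, l0 *: Res x - Td (Res x) = x &
      forall x, Res (l0 *: x - Td x) = x].
Proof.
have l00 := lambda_gt0; have C0 := C_ge0 phi0.
pose D := C phi0 + l0 * `|h0|.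
have D0 : 0 <= D by rewrite addr_ge0// mulr_ge0// ltW.
have TdD g : `|TdL g| <= D * `|g|.
  rewrite mulrDl (le_trans (ler_normB _ _))// lerD//.
  rewrite (le_trans (norm_l0h0 g))// ler_wpM2l ?sup_norm_le_norm//.
  by rewrite mulr_ge0// ltW.
pose Z := D + l0 + 1.
have [||c c0 cP] := lasota_yorke_bounded_below M_compact alpha_gt0 _ rate_lt
    lambda_gt0 Td_sup Td_hoelder (Z := Z).
- by rewrite addr_ge0// mulr_ge0// ltW.
- by move=> z w /andP[lz _]; exact: deflated_injective.
have sj := resolvent_surjective TdD (_ : D < Z) (_ : 0 < Z) c0 cP.
pose A : {linear V -> V} := (l0 \*: idfun) \- TdL.
have l0Z : l0 <= l0 <= Z by rewrite lexx /Z; lra.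
have [||S [SA AS Sc]] := @bounded_below_inverse R V V A c c0.
- by move=> x; exact: cP l0Z.
- by move=> y; apply: (sj _ _ l0 y l0Z); rewrite /Z; lra.
by exists S, c^-1; split=> //; rewrite invr_ge0 ltW.
Qed.

Hypothesis lambda_eigenvalue : \forall phi \near phi0,
  exists2 g, g != 0 & transfer f phi g = lambda f phi *: g.

(** Upper semicontinuity of the largest eigenvalue: beyond [l0 + e] the operator
    [z - T] is bounded below, and the perturbation is too small to create an
    eigenvalue. *)
Lemma perturbed_eigenvalue_lt (e c s lam : R) (H g : V) :
  (forall z u, l0 + e <= z <= 2 * C phi0 -> c * `|u| <= `|z *: u - T u|) ->
  s <= 1 -> C phi0 * s < c -> `|hexp H - hone| <= s ->
  g != 0 -> T (hmul (hexp H) g) = lam *: g -> lam < l0 + e.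
Proof.
move=> cP s1 sc Es g0 gE; have C0 := C_ge0 phi0.
have ng : 0 < `|g| by rewrite normr_gt0.
have Eg : `|hmul (hexp H - hone) g| <= s * `|g|.
  by rewrite (le_trans (norm_hmul _ _))// ler_wpM2r.
have hE : hmul (hexp H) g = g + hmul (hexp H - hone) g by hoelder_ring.
have Tg : `|lam *: g - T g| <= C phi0 * s * `|g|.
  rewrite -gE hE linearD addrC addKr (le_trans (norm_T0 _))// -mulrA.
  by rewrite ler_wpM2l.
have lamC : lam <= 2 * C phi0.
  suff : lam * `|g| <= C phi0 * (2 * `|g|).
    by rewrite [leRHS]mulrCA [leRHS]mulrA ler_pM2r.
  apply: (@le_trans _ _ `|lam *: g|).
    by rewrite normrZ ler_wpM2r// ler_norm.
  rewrite -gE (le_trans (norm_T0 _))// ler_wpM2l// hE.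
  rewrite (le_trans (ler_normD _ _))// mulr_natl mulr2n lerD2l.
  by rewrite (le_trans Eg)// ler_piMl.
rewrite ltNge; apply/negP => lam_ge.
have := cP lam g; rewrite lam_ge lamC => /(_ isT)/le_trans/(_ Tg).
by rewrite ler_pM2r// leNgt sc.
Qed.

(** [lambda (phi0 + H)] is at least the perturbed eigenvalue, because it is a
    spectral radius; it is less than [l0 + eta], because it is an eigenvalue
    itself; and near [l0] there is only one eigenvalue. *)
Theorem lambda_expansion :
  exists (P : nat -> (nat -> V) -> R^o) (B : nat -> R) (K' rho : R),
  [/\ 0 < rho, forall n, multilinear_upto n (P n),
      forall n v, `|P n v| <= B n * \prod_(i < n) `|v i|,
      forall v, P 1%N v = l0 * nu (hmul (v 0%N) h0) &
      forall H, rho * `|H| <= 1 / 4 -> forall N,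
        `|lambda f (phi0 + H) - \sum_(0 <= n < N) P n (fun=> H)| <=
          K' * (rho * `|H|) ^+ N].
Proof.
have l00 := lambda_gt0; have C0 := C_ge0 phi0.
have [Res [b [b0 Resb ResK KRes]]] := deflated_resolvent.
have [P [B [K' [rho [rho0 Pm Pb P01 Psol]]]]] := eigenvalue_branch
  l00 C0 b0 norm_T0 nu_norm T_h0 nu_T nu_h0 Resb ResK.
have [eta eta0 uniq_z] := eigenvalue_unique l00 C0 b0 norm_T0 nu_norm
  nu_T nu_h0 Resb KRes.
have [c c0 cP] := resolvent_bounded_below (2 * C phi0) eta0.
have [r /= r0 rP] : exists2 r : R, 0 < r & forall H : V, `|H| < r ->
    exists2 g, g != 0 & transfer f (phi0 + H) g = lambda f (phi0 + H) *: g.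
  have /nbhs_ballP[r /= r0 rP] := lambda_eigenvalue; exists r => // H Hr.
  by apply: rP; rewrite -ball_normE /= opprD addrA subrr sub0r normrN.
have K0 : 0 <= K'.
  have := Psol 0; rewrite normr0 mulr0 => /(_ _)[|z [w [_ _ _ /(_ 0%N)]]].
    by rewrite divr_ge0.
  by rewrite expr0 mulr1; apply: le_trans.
have [s [s0 s1 se sc]] := small_scale eta0 c0 C0.
have [rho' rho_le small] := refined_rate rho0 K0 r0 s0.
have rho'0 : 0 < rho' by exact: lt_le_trans rho_le.
exists P, B, K', rho'; split => //; first by move=> v; have [] := P01 v.
move=> H Hr N; have [Hrho HR Hs H4 KH] := small _ (normr_ge0 H) Hr.
have [z [w [w0 zw wb zP]]] := Psol H Hrho.
suff -> : lambda f (phi0 + H) = z.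
  apply: (le_trans (zP N)); rewrite ler_wpM2l// lerXn2r ?nnegrE//.
  - by rewrite mulr_ge0// ltW.
  - by rewrite mulr_ge0// ltW.
  - by rewrite ler_wpM2r.
have zl : `|z - l0| <= s.
  have := zP 1%N; rewrite big_nat1 expr1 (P01 _).1 => /le_trans; apply.
  exact: KH.
have EE : `|hexp H - hone| <= 2 * s.
  by rewrite (le_trans (norm_hexpB1 H4))// ler_wpM2l.
have g1_neq0 : h0 + w != 0.
  apply: contra_eq_neq nu_h0 => hw.
  have : nu (h0 + w) = 1 by rewrite linearD nu_h0 w0 addr0.
  by rewrite hw linear0 => /esym/eqP; rewrite oner_eq0.
have zlam : z <= lambda f (phi0 + H).
  apply: (le_trans (ler_norm z)); apply: (eigenvalue_le_lambda g1_neq0).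
  by rewrite TD; exact: zw.
have [g g0 gE] := rP H HR; rewrite TD in gE.
have laml := perturbed_eigenvalue_lt cP s1 sc EE g0 gE.
apply: (uniq_z H w g z (lambda f (phi0 + H))) => //.
- by rewrite (le_trans wb)// (le_trans KH)// (le_trans _ s1)// ler_peMl ?ler1n// ltW.
- exact: le_trans EE se.
rewrite ler_distl (ltW laml) andbT (le_trans _ zlam)//.
move: zl; rewrite ler_distl => /andP[+ _]; apply: le_trans.
by rewrite lerD2l lerN2 (le_trans _ se)// ler_peMl ?ler1n// ltW.
Qed.

End LeadingEigenvalue.

(** The Lasota-Yorke rate of the operator lies strictly below the trivial lower
    bound of the leading eigenvalue: the oscillation of [phi] costs a factor
    [e^eps], and the first of the two smallness conditions absorbs it. *)
Lemma total_rate_contraction (R : realType) (M : pointedMetricType R)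
  (p q m : nat) (sigma L alpha eps : R) (phi : hoelder_space M alpha) :
  (q < p)%N -> 0 < sigma -> 0 < eps -> cond_E1 M alpha eps L sigma q p m ->
  hyp_P eps phi ->
  expR (sup (range phi)) * total_rate p q sigma L alpha <
    p%:R * expR (inf (range phi)).
Proof.
move=> qp sigma0 eps0 E1 [osc _].
have p0 : 0 < p%:R :> R by rewrite ltr0n (leq_ltn_trans _ qp).
set K := const_K alpha L sigma q p.
have KE : total_rate p q sigma L alpha <= p%:R * K.
  rewrite /K /const_K mulrC divfK ?gt_eqF// /total_rate lerD2l mulrDr mulr1.
  by rewrite lerDl !mulr_ge0 ?powR_ge0.
have k0 : 0 <= total_rate p q sigma L alpha by apply: total_rate_ge0; exact: ltnW.
have K1 : expR eps * K < 1.
  apply: le_lt_trans E1; rewrite lerDl !mulr_ge0 ?powR_ge0//.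
  exact: ltW.
set S := sup _ in osc *; set I := inf _ in osc *.
have SI : expR S <= expR I * expR eps.
  by rewrite -expRD ler_expR; lra.
apply: (@le_lt_trans _ _ (expR I * expR eps * (p%:R * K))).
  by rewrite ler_pM ?expR_ge0.
rewrite (_ : _ * _ = p%:R * expR I * (expR eps * K)); last by ring.
by rewrite gtr_pMr// mulr_gt0// expR_gt0.
Qed.

Theorem proposition4p5 (R : realType) (M : pointedMetricType R)
  (HM : compact_connected_riemannian_manifold M)
  (f : M -> M) (Hf : local_homeomorphism f)
  (Lf : M -> R) (HLf : inverse_branch_lipschitz f Lf)
  (p : nat) (Hp : has_degree f p)
  (sigma L : R) (Hsigma : 1 < sigma) (HL : 1 <= L)
  (A : set M) (HA : open A)
  (H1 : hyp_H1 Lf A sigma L)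
  (q : nat) (Hqp : (q < p)%N) (H2 : hyp_H2 f A q)
  (alpha : R) (Halpha : 0 < alpha)
  (eps delta : R) (m : nat)
  (Heps : 0 < eps) (Hdelta : 0 < delta) (Hm : (0 < m)%N)
  (Hloc : local_to_global M alpha delta m)
  (E1 : cond_E1 M alpha eps L sigma q p m)
  (E2 : cond_E2 alpha eps L sigma q p)
  (W : set (hoelder_space M alpha)) (HW : open W)
  (HWP : forall phi, W phi -> hyp_P eps phi)
  (nu : hoelder_space M alpha -> probability (borel M) R)
  (h : hoelder_space M alpha -> hoelder_space M alpha)
  (Hnu : forall phi, W phi -> conformal f phi (nu phi))
  (Hh : forall phi, W phi ->
     unique (normalized_eigenfunction f phi (nu phi)) (h phi)) :
  analytic_on W (lambda f : hoelder_space M alpha -> R) /\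
  forall phi0 : hoelder_space M alpha, W phi0 ->
    differentiable (lambda f : hoelder_space M alpha -> R) phi0 /\
    forall H : hoelder_space M alpha,
      'd (lambda f : hoelder_space M alpha -> R) phi0 H =
        lambda f phi0 * \int[nu phi0]_x (h phi0 x * H x).
Proof.
have Mc : compact [set: M] by case: HM.
have sigma0 : 0 < sigma by lra.
have [d d0 matched] := matched_fibres_uniform Hf Hp HLf H1 H2 Mc.
have eigen phi : W phi -> exists2 g : hoelder_space M alpha,
    g != 0 & transfer f phi g = lambda f phi *: g.
  move=> Wphi; have [[hE h1] _] := Hh phi Wphi; exists (h phi).
    apply: contra_eq_neq h1 => ->.
    rewrite -[X in X != _]/(integral_functional (nu phi) 0).
    by rewrite (lin0 (integral_linear Halpha (nu phi))) eq_sym oner_eq0.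
  apply: hoelder_ext => x; rewrite evalZ -hE.
  by rewrite (transferE Hp Hsigma HL (ltnW Hqp) Halpha d0 matched).
have near_eigen phi0 : W phi0 -> \forall phi \near phi0,
    exists2 g, g != 0 & transfer f phi g = lambda f phi *: g.
  by move=> W0; apply: filterS eigen (open_nbhs_nbhs (conj HW W0)).
have expansion phi0 (W0 : W phi0) := lambda_expansion Mc Hp Hsigma HL Hqp Halpha
  d0 matched (Hnu phi0 W0) (Hh phi0 W0) (lt_le_trans
    (total_rate_contraction Hqp sigma0 Heps E1 (HWP phi0 W0))
    (lambda_ge Hp Hsigma HL Hqp Halpha d0 matched (Hnu phi0 W0)))
  (near_eigen phi0 W0).
split=> [phi0 W0|phi0 W0].
  have [P [B [K [rho [rho0 Pm Pb _ Pa]]]]] := expansion phi0 W0.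
  exact: (power_series_analytic Pm Pb rho0 Pa).
have [P [B [K [rho [rho0 Pm Pb P1 Pa]]]]] := expansion phi0 W0.
have [dl dE] := power_series_differentiable Pm Pb rho0 Pa.
split=> // H; rewrite dE P1; congr (_ * _).
rewrite /= /integral_functional; apply: eq_Rintegral => x _.
by rewrite hmulE mulrC.
Qed.
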